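(* Consider the control system with state $x=(x_1,\dots,x_{12})$ and control inputs $u=(u_1,\dots,u_5)$ (not subject to bounds) given by $$ \begin{aligned} \dot x_1&=-\tfrac{1}{R_1C_1}x_1-\tfrac1{C_1}x_3+\tfrac1{R_1C_1}V_{PV},\\ \dot x_2&=-\tfrac1{R_2C_2}x_2+\tfrac1{C_2}x_3-\tfrac1{C_2}u_1x_3+\tfrac1{R_2C_2}x_9,\\ \dot x_3&=\tfrac1{L_3}x_1-\tfrac1{L_3}x_2-\tfrac{R_{01}}{L_3}x_3+\tfrac1{L_3}x_2u_1+\tfrac{R_{01}-R_{02}}{L_3}x_3u_1,\\ \dot x_4&=-\tfrac1{R_4C_4}x_4-\tfrac1{C_4}x_6+\tfrac1{R_4C_4}V_B,\\ \dot x_5&=-\tfrac1{R_5C_5}x_5+\tfrac1{C_5}x_6-\tfrac1{C_5}u_2x_6+\tfrac1{R_5C_5}x_9,\\ \dot x_6&=\tfrac1{L_6}x_4-\tfrac1{L_6}x_5-\tfrac{R_{04}}{L_6}x_6+\tfrac1{L_6}x_5u_2,\\ \dot x_7&=-\tfrac1{R_7C_7}x_7-\tfrac1{C_7}x_8+\tfrac1{R_7C_7}x_9,\\ \dot x_8&=\tfrac1{L_8}V_Su_3-\tfrac{R_{08}}{L_8}x_8-\tfrac1{L_8}x_7,\\ \dot x_9&=\tfrac1{C_9}\Big(\tfrac1{R_2}(x_2-x_9)+\tfrac1{R_5}(x_5-x_9)+\tfrac1{R_7}(x_7-x_9)+\tfrac1{R_{10}}(x_{10}-x_9)-\tfrac1{R_L}x_9\Big),\\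 \dot x_{10}&=-\tfrac{3}{2C_{10}}\tfrac1{x_{10}}\big(v_{ld}x_{11}+v_{lq}x_{12}\big)+\tfrac1{R_{10}C_{10}}(x_9-x_{10}),\\ \dot x_{11}&=\tfrac1{L_{11}}\big[-R_{11}x_{11}+\omega x_{12}+\tfrac12x_{10}u_4-v_{ld}\big],\\ \dot x_{12}&=\tfrac1{L_{11}}\big[-R_{11}x_{12}-\omega x_{11}+\tfrac12x_{10}u_5-v_{lq}\big]. \end{aligned} $$ Let the load resistance $R_L>0$ be constant, and let constant references $x_1^*,x_4^*,x_9^*,x_{11}^*,x_{12}^*$ be given such that $x_1^*$ and $x_4^*$ allow power balance in steady state with respect to the demanded currents $x_{11}^*,x_{12}^*$ at the desired grid voltage $x_9^*$; that is, there are corresponding steady-state values $x_2^*,x_5^*,x_{10}^*$ (as defined in the context). Then there exist control inputs $u_1,u_2,u_3,u_4,u_5$ such that the system is asymptotically stable in closed loop around the equilibrium point $$ x^e=\Big(x_1^*,\;x_2^*,\;\tfrac1{R_1}(V_{PV}-x_1^* ),\;x_4^*,\;x_5^*,\;\tfrac1{R_4}(V_B-x_4^* ),\;x_9^*,\;0,\;x_9^*,\;x_{10}^*,\;x_{11}^*,\;x_{12}^*\Big). $$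
   Context: The system is an averaged model of a DC microgrid connected to an AC grid: $x_1,x_2,x_4,x_5,x_7,x_9,x_{10}$ are capacitor voltages ($x_9$ is the DC grid voltage), $x_3,x_6,x_8$ are inductor currents, and $x_{11},x_{12}$ are the $d$ and $q$ components of the AC-side inductor current. The model is considered where $x_{10}\neq 0$. Parameters: $C_1,C_2,C_4,C_5,C_7,C_9,C_{10}$, $R_1,R_2,R_{01},R_{02},R_4,R_{04},R_5,R_7,R_{08},R_{10},R_{11},R_L$, $L_3,L_6,L_8,L_{11}$ are known positive constants. $V_{PV}>0$ (photovoltaic array voltage) and $V_B>0$ (battery voltage) are constants. $V_S=V_S(t)>0$ (supercapacitor voltage) is slowly time-varying and known at each time $t$. $v_{ld}\ge 0$, $v_{lq}\ge 0$ (AC voltages) and $\omega$ (AC grid frequency) are known constants. References: $x_1^*,x_4^*,x_9^*,x_{11}^*,x_{12}^*$ are the desired constant values of $x_1,x_4,x_9,x_{11},x_{12}$, provided by a higher-level controller. Steady-state values and power balance: $x_2^*,x_5^*,x_{10}^*$ denote the steady-state values of $x_2,x_5,x_{10}$ corresponding to the given references. That the references ''allow power balance in steady state'' means that $x_2^*,x_5^*,x_{10}^*$ (with $x_{10}^*\ne0$) exist such that, for suitable input values $u^e=(u_1^e,\dots,u_5^e)$ ($u_3^e$ possibly depending on $V_S$), all right-hand sides of the system vanish at $(x,u)=(x^e,u^e)$. In particular, the $x_9$-equation at $x^e$ (where $x_7=x_9=x_9^*$) gives the power balance condition $$\frac{x_9^*}{R_L}=\frac1{R_2}(x_2^*-x_9^*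 )+\frac1{R_5}(x_5^*-x_9^* )+\frac1{R_{10}}(x_{10}^*-x_9^* ).$$ Control inputs are feedback laws that may depend on the state $x$, on the known parameters, voltages and references above, and on additional integral states $\alpha_i$ governed by their own differential equations (dynamic feedback). Asymptotic stability in closed loop around $x^e$ is meant in the usual (local, Lyapunov) sense for the closed-loop system. *)

(* Defs.v *)
(* MathComp-Analysis *)
From HB Require Import structures.
From mathcomp Require Import all_boot all_order all_algebra.
From mathcomp Require Import all_classical all_reals all_analysis.

Set Implicit Arguments.
Unset Strict Implicit.
Unset Printing Implicit Defensive.
Import Order.TTheory GRing.Theory Num.Theory.
Import numFieldNormedType.Exports.

Local Open Scope classical_set_scope.
Local Open Scope ring_scope.

Record microgrid (R : realType) := Microgrid {
  C1 : R; C2 : R; C4 : R; C5 : R; C7 : R; C9 : R; C10 : R;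
  R1 : R; R2 : R; R01 : R; R02 : R; R4 : R; R04 : R; R5 : R; R7 : R;
  R08 : R; R10 : R; R11 : R; RL : R;
  L3 : R; L6 : R; L8 : R; L11 : R;
  VPV : R; VB : R;
  vld : R; vlq : R; omega : R }.

(* The sign of the grid frequency omega is not constrained. *)
Definition physical (R : realType) (p : microgrid R) : Prop :=
  [/\ [/\ 0 < C1 p, 0 < C2 p, 0 < C4 p & 0 < C5 p],
      [/\ 0 < C7 p, 0 < C9 p & 0 < C10 p],
      [/\ 0 < R1 p, 0 < R2 p, 0 < R01 p & 0 < R02 p] /\
      [/\ 0 < R4 p, 0 < R04 p, 0 < R5 p & 0 < R7 p],
      [/\ 0 < R08 p, 0 < R10 p, 0 < R11 p & 0 < RL p] /\
      [/\ 0 < L3 p, 0 < L6 p, 0 < L8 p & 0 < L11 p] &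
      [/\ 0 < VPV p, 0 < VB p, 0 <= vld p & 0 <= vlq p]].

(* Components are numbered from 1: [entry v 1] is the first entry of v. *)
Definition entry (R : realType) (n : nat) (v : 'rV[R]_n.+1) (k : nat) : R :=
  v ord0 (inord k.-1).

Definition vec (R : realType) (n : nat) (s : seq R) : 'rV[R]_n :=
  \row_(i < n) s`_i.

(* Right-hand side of the averaged model; vS is the current value of V_S.
   As 0^-1 = 0 in the library, it is meaningful only where x10 != 0: see
   [model_domain]. *)
Definition rhs (R : realType) (p : microgrid R) (vS : R)
    (x : 'rV[R]_12) (u : 'rV[R]_5) : 'rV[R]_12 :=
  let x1 := entry x 1 in let x2 := entry x 2 in let x3 := entry x 3 in
  let x4 := entry x 4 in let x5 := entry x 5 in let x6 := entry x 6 in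
  let x7 := entry x 7 in let x8 := entry x 8 in let x9 := entry x 9 in
  let x10 := entry x 10 in let x11 := entry x 11 in let x12 := entry x 12 in
  let u1 := entry u 1 in let u2 := entry u 2 in let u3 := entry u 3 in
  let u4 := entry u 4 in let u5 := entry u 5 in
  vec 12 [::
    - (1 / (R1 p * C1 p)) * x1 - 1 / C1 p * x3 + 1 / (R1 p * C1 p) * VPV p;
    - (1 / (R2 p * C2 p)) * x2 + 1 / C2 p * x3 - 1 / C2 p * u1 * x3
      + 1 / (R2 p * C2 p) * x9;
    1 / L3 p * x1 - 1 / L3 p * x2 - R01 p / L3 p * x3 + 1 / L3 p * x2 * u1
      + (R01 p - R02 p) / L3 p * x3 * u1;
    - (1 / (R4 p * C4 p)) * x4 - 1 / C4 p * x6 + 1 / (R4 p * C4 p) * VB p;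
    - (1 / (R5 p * C5 p)) * x5 + 1 / C5 p * x6 - 1 / C5 p * u2 * x6
      + 1 / (R5 p * C5 p) * x9;
    1 / L6 p * x4 - 1 / L6 p * x5 - R04 p / L6 p * x6 + 1 / L6 p * x5 * u2;
    - (1 / (R7 p * C7 p)) * x7 - 1 / C7 p * x8 + 1 / (R7 p * C7 p) * x9;
    1 / L8 p * vS * u3 - R08 p / L8 p * x8 - 1 / L8 p * x7;
    1 / C9 p * (1 / R2 p * (x2 - x9) + 1 / R5 p * (x5 - x9)
      + 1 / R7 p * (x7 - x9) + 1 / R10 p * (x10 - x9) - 1 / RL p * x9);
    - (3 / (2 * C10 p)) * (1 / x10) * (vld p * x11 + vlq p * x12)
      + 1 / (R10 p * C10 p) * (x9 - x10);
    1 / L11 p * (- R11 p * x11 + omega p * x12 + 1 / 2 * x10 * u4 - vld p);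
    1 / L11 p * (- R11 p * x12 - omega p * x11 + 1 / 2 * x10 * u5 - vlq p)].

Definition model_domain (R : realType) (x : 'rV[R]_12) : Prop :=
  entry x 10 != 0.

Definition xeq (R : realType) (p : microgrid R)
    (x1s x2s x4s x5s x9s x10s x11s x12s : R) : 'rV[R]_12 :=
  vec 12 [:: x1s; x2s; 1 / R1 p * (VPV p - x1s);
             x4s; x5s; 1 / R4 p * (VB p - x4s);
             x9s; 0; x9s; x10s; x11s; x12s].

(* x2s, x5s, x10s are steady-state values of x2, x5, x10 for the given
   references.  Only the third steady-state input may depend on the value of
   V_S. *)
Definition power_balance (R : realType) (p : microgrid R)
    (x1s x2s x4s x5s x9s x10s x11s x12s : R) : Prop :=
  x10s != 0 /\
  exists (u1 u2 : R) (u3 : R -> R) (u4 u5 : R), forall vS : R, 0 < vS ->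
    rhs p vS (xeq p x1s x2s x4s x5s x9s x10s x11s x12s)
      (vec 5 [:: u1; u2; u3 vS; u4; u5]) = 0.

Section AsymptoticStability.
Variables (R : realType) (V : normedModType R).
(* The differential equation z' = F t z, for z in the domain D. *)
Variables (F : R -> V -> V) (D : V -> Prop).

(* Solution on [t0, T[, where T may be +oo; z is a total function whose values
   outside this interval are irrelevant. *)
Definition is_solution (t0 : R) (T : \bar R) (z : R -> V) : Prop :=
  [/\ {within [set t : R | t0 <= t /\ (t%:E < T)%E], continuous z},
      forall t : R, t0 <= t -> (t%:E < T)%E -> D (z t) &
      forall t : R, t0 < t -> (t%:E < T)%E ->
        is_derive t (1 : R) z (F t (z t))].

Definition is_equilibrium (ze : V) : Prop :=
  D ze /\ forall t : R, 0 <= t -> F t ze = 0.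

(* Quantifying over solutions on all intervals [t0, T[ also covers solutions
   not known in advance to be global. *)
Definition lyapunov_stable (ze : V) : Prop :=
  forall t0 : R, 0 <= t0 -> forall e : R, 0 < e ->
  exists2 d : R, 0 < d &
    forall (T : \bar R) (z : R -> V), is_solution t0 T z ->
      `|z t0 - ze| < d ->
      forall t : R, t0 <= t -> (t%:E < T)%E -> `|z t - ze| < e.

Definition locally_attractive (ze : V) : Prop :=
  forall t0 : R, 0 <= t0 ->
  exists2 d : R, 0 < d &
    (forall z0 : V, `|z0 - ze| < d ->
      exists2 z : R -> V, is_solution t0 +oo%E z & z t0 = z0) /\
    (forall z : R -> V, is_solution t0 +oo%E z -> `|z t0 - ze| < d ->
      z t @[t --> +oo] --> ze).

Definition asymptotically_stable (ze : V) : Prop :=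
  [/\ is_equilibrium ze, lyapunov_stable ze & locally_attractive ze].

End AsymptoticStability.

(* Dynamic feedback with controller state alpha in R^n:
     u = kappa (V_S, (x, alpha)),   alpha' = eta (V_S, (x, alpha)).
   Only the current value of V_S is available to it. *)
Record feedback (R : realType) (n : nat) := Feedback {
  kappa : R * ('rV[R]_12 * 'rV[R]_n) -> 'rV[R]_5;
  eta : R * ('rV[R]_12 * 'rV[R]_n) -> 'rV[R]_n }.

Definition continuous_near (R : realType) (n : nat) (fb : feedback R n)
    (ze : 'rV[R]_12 * 'rV[R]_n) : Prop :=
  \forall z \near ze, forall vS : R, 0 < vS ->
    {for (vS, z), continuous (kappa fb)} /\ {for (vS, z), continuous (eta fb)}.

Definition closed_loop (R : realType) (n : nat) (p : microgrid R)
    (fb : feedback R n) (VS : R -> R) (t : R) (z : 'rV[R]_12 * 'rV[R]_n) :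
    'rV[R]_12 * 'rV[R]_n :=
  (rhs p (VS t) z.1 (kappa fb (VS t, z)), eta fb (VS t, z)).

(* Main.v *)
From HB Require Import structures.
Require Import Defs.
From mathcomp Require Import all_boot all_order all_algebra.
From mathcomp Require Import all_classical all_reals all_analysis.
From mathcomp Require Import ring lra.
Import Order.TTheory GRing.Theory Num.Theory.
Import numFieldNormedType.Exports.
Local Open Scope classical_set_scope.
Local Open Scope ring_scope.

(* Keep u1 and u2 at their steady-state values, let u3 cancel V_S, and let u4, u5
   impose (x11/x10)' = x11*/x10* - x11/x10, and likewise for x12/x10.  In the
   coordinates (x1, ..., x10, x11/x10, x12/x10) the system is then exactly linear,
   time-invariant, and has one remaining input w, which drives x8.

   The loop (x4, x5, x6) dissipates its stored energy, and x10 is a stable scalar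
   equation.  If the effective resistance R01 d + R02 (1 - d) of the loop
   (x1, x2, x3), with d = 1 - u1, is positive, then that loop dissipates too, and
   it is enough that w stabilizes x9 through the chain w -> x8 -> x7 -> x9.
   Otherwise d <> 0, and w stabilizes x1 through the longer chain
   w -> x8 -> x7 -> x9 -> x2 -> x3 -> x1.  In both cases a quadratic Lyapunov
   function is built by a cascade.  It bounds every local solution, and solutions
   exist because those of the linear system are power series in time. *)

Set Implicit Arguments.
Unset Strict Implicit.
Unset Printing Implicit Defensive.

(** * Linear differential equations *)

Lemma is_derive_mxP (R : realFieldType) (V : normedModType R) (m n : nat)
    (M : V -> 'M[R]_(m, n)) (dM : 'M[R]_(m, n)) (t v : V) :
  is_derive t v M dM <-> forall i j, is_derive t v (fun s => M s i j) (dM i j).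
Proof.
split=> [[dMt <-] i j|dMt].
- move/derivable_mxP: (dMt) => dMij.
  by apply: DeriveDef; [exact: dMij | rewrite derive_mx// mxE].
- have dM1 : derivable M t v.
    by apply/derivable_mxP => i j; have [] := dMt i j.
  apply: DeriveDef => //; rewrite derive_mx//.
  by apply/matrixP => i j; rewrite mxE; have [_ ->] := dMt i j.
Qed.

Lemma is_derive_pairP (R : realFieldType) (V W : normedModType R)
    (z : R -> V * W) (t : R) (dz : V * W) :
  is_derive t (1 : R) z dz <->
  is_derive t (1 : R) (fun s => (z s).1) dz.1 /\
  is_derive t (1 : R) (fun s => (z s).2) dz.2.
Proof.
have dE (U : normedModType R) (f : R -> U) (df : U) :
    is_derive t (1 : R) f df <->
    h^-1 *: (f (h *: (1 : R) + t) - f t) @[h --> 0^'] --> df.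
  split=> [[df1 <-]|fdf]; first exact: df1.
  apply: DeriveDef; first by apply/cvg_ex; exists df.
  exact/cvg_lim.
split=> [/dE dzt|[/dE d1 /dE d2]].
- split; apply/dE.
  + by have := cvg_comp _ _ dzt (@cvg_fst _ _ _ _ _); apply.
  + by have := cvg_comp _ _ dzt (@cvg_snd _ _ _ _ _); apply.
- by apply/dE; case: dz d1 d2 => a b; apply: cvg_pair.
Qed.

Section LinearODE.
Variables (R : realType) (n : nat) (A : 'M[R]_n).

(** Taylor coefficients at 0 of the i-th entry of v exp(tA). *)
Let coef (v : 'rV[R]_n) (i : 'I_n) (k : nat) : R :=
  (iter k (mulmx^~ A) v) ord0 i / k`!%:R.

(** Termwise differentiation of the exponential series amounts to multiplying the initial vector by
    [A]. *)
Let coef_diffs v i : pseries_diffs (coef v i) = coef (v *m A) i.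
Proof.
apply/funext => k; rewrite /pseries_diffs /coef /= -iterSr /= factS natrM.
rewrite invfM mulrCA mulVKf//.
Qed.

(** A geometric bound, used to compare the series with a multiple of the exponential series. [K]
    sums all the |A i j|, hence dominates every column sum. *)
Let iter_le (v : 'rV[R]_n) : exists2 B, 0 <= B & exists2 K, 0 <= K &
  forall i k, `|(iter k (mulmx^~ A) v) ord0 i| <= B * K ^+ k.
Proof.
pose K := \sum_i \sum_j `|A i j|; pose B := \sum_i `|v ord0 i|.
have B0 : 0 <= B by apply: sumr_ge0.
have K0 : 0 <= K by apply: sumr_ge0 => i _; apply: sumr_ge0.
exists B => //; exists K => // i k.
elim: k i => [|k IH] i /=.
  by rewrite expr0 mulr1 /B (bigD1 i)//= lerDl sumr_ge0.
rewrite mxE (le_trans (ler_norm_sum _ _ _))// exprSr mulrA mulr_sumr.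
apply: ler_sum => j _; rewrite normrM ler_pM//.
by rewrite (bigD1 i)//= lerDl sumr_ge0.
Qed.

Let is_cvg_coef (v : 'rV[R]_n) i x : cvgn (pseries (coef v i) x).
Proof.
have [B B0 [K K0 vle]] := iter_le v.
apply: normed_cvg.
apply: (@series_le_cvg _ _ (fun k => B * exp_coeff (K * `|x|) k)) => [k|k|k|].
- exact: normr_ge0.
- by rewrite mulr_ge0// exp_coeff_ge0// mulr_ge0.
- rewrite /coef /exp_coeff /= !normrM normfV normr_nat normrX exprMn.
  by rewrite mulrAC !mulrA ler_pM2r ?invr_gt0 ?ltr0n ?fact_gt0// ler_wpM2r ?exprn_ge0.
- exact/is_cvg_seriesZ/is_cvg_series_exp_coeff.
Qed.

Let sol v (t : R) : 'rV[R]_n := \row_i limn (pseries (coef v i) t).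

(** Partial sums commute with multiplication by [A], which is a finite linear combination of
    entries, and this passes to the limit. *)
Let sol_mulmx v t : sol (v *m A) t = sol v t *m A.
Proof.
apply/rowP => i; rewrite !mxE.
apply/cvg_lim => //.
rewrite (_ : pseries _ _ =
    fun N => \sum_j pseries (coef v j) t N * A j i); last first.
  apply/funext => N; rewrite /pseries /series /=.
  under [RHS]eq_bigr do rewrite mulr_suml.
  rewrite exchange_big /=; apply: eq_bigr => k _.
  rewrite /coef -iterSr /= mxE !mulr_suml; apply: eq_bigr => j _.
  by rewrite mulrAC -!mulrA; congr (_ * _); ring.
under [X in _ --> X]eq_bigr do rewrite mxE.
apply: cvg_big => [|j _]; first exact: add_continuous.
by apply: cvgMr_tmp; exact: is_cvg_coef.
Qed.

Lemma linear_ode_solution (t0 : R) (v : 'rV[R]_n) :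
  exists2 y : R -> 'rV[R]_n, y t0 = v &
    forall t, is_derive t (1 : R) y (y t *m A).
Proof.
exists (fun t => sol v (t - t0)).
  apply/rowP => i; rewrite mxE subrr; apply/cvg_lim => //.
  (* The partial sum of index 0 is empty; from index 1 on, all partial sums at time 0 equal the
     constant term. *)
  rewrite -(cvg_shiftS _) /=.
  rewrite (_ : (fun _ => _) = fun=> v ord0 i); first exact: cvg_cst.
  apply/funext => N; rewrite /pseries /series /= big_nat_recl//= /coef /=.
  rewrite big1 ?addr0 ?expr0 ?fact0 ?divr1 ?mulr1// => k _.
  by rewrite expr0n mulr0.
move=> t; apply/is_derive_mxP => i j; rewrite ord1 -sol_mulmx mxE.
rewrite (_ : (fun s => _) =
    (fun x => limn (pseries (coef v j) x)) \o (fun s => s + - t0)); last first.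
  by apply/funext => s; rewrite /= mxE.
rewrite -coef_diffs.
rewrite -[limn _]mulr1; apply: is_derive1_comp.
  (* Differentiation under the sum needs convergence at some radius larger than |t - t0|; the series
     converges everywhere. *)
  apply: (@pseries_snd_diffs _ _ (`|t - t0| + 1)).
  - exact: is_cvg_coef.
  - by rewrite coef_diffs; exact: is_cvg_coef.
  - by rewrite !coef_diffs; exact: is_cvg_coef.
  - by rewrite [ltRHS]ger0_norm ?addr_ge0// ltrDl.
exact: is_derive_shift.
Qed.

End LinearODE.

(** Grönwall's argument: v(t) exp(c (t - t0)) has nonpositive derivative, hence is nonincreasing. At
    [t0] itself only continuity from within the interval is available. *)
Lemma decay_le (R : realType) (t0 : R) (T : \bar R) (v dv : R -> R) (c : R) :
  {within [set t : R | t0 <= t /\ (t%:E < T)%E], continuous v} ->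
  (forall t, t0 < t -> (t%:E < T)%E -> is_derive t (1 : R) v (dv t)) ->
  (forall t, t0 < t -> (t%:E < T)%E -> dv t <= - c * v t) ->
  forall t, t0 <= t -> (t%:E < T)%E -> v t <= v t0 * expR (- c * (t - t0)).
Proof.
move=> cv dvP dvle t t0t tT.
pose E s := expR (c * (s - t0)).
have dE s : is_derive s (1 : R) E (c * E s).
  rewrite mulrC /E (_ : (fun _ => _) = expR \o (fun s => c * (s - t0)))//.
  apply: is_derive1_comp.
  rewrite -[X in is_derive _ _ _ X]mulr1.
  have := is_derive_shift s 1 (- t0) => dsh.
  exact: (@is_deriveZ _ _ _ (shift (- t0)) c s 1 1 dsh).
pose w := v \* E.
have dw s : t0 < s -> (s%:E < T)%E ->
    is_derive s (1 : R) w (v s * (c * E s) + E s * dv s).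
  by move=> t0s sT; have dvs := dvP s t0s sT; exact: is_deriveM.
have lt_T s : s <= t -> (s%:E < T)%E.
  by move=> st; apply: le_lt_trans tT; rewrite lee_fin.
have wle : w t <= w t0.
  apply: (@ler0_derive1_le_cc _ w t0 t) => //.
  - move=> s; rewrite in_itv/= => /andP[t0s st].
    by have [] := dw s t0s (lt_T _ (ltW st)).
  - move=> s; rewrite in_itv/= => /andP[t0s st].
    have := dw s t0s (lt_T _ (ltW st)); rewrite derive1E => -[_ ->].
    have := dvle s t0s (lt_T _ (ltW st)); have := expR_gt0 (c * (s - t0)).
    rewrite -/(E s); nra.
  - move=> s; apply: (@continuousM _ (subspace `[t0, t]) v E s).
    + move: s; apply: continuous_subspaceW cv => s /=.
      by rewrite in_itv/= => /andP[? st]; split => //; exact: lt_T.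
    + apply: (@continuous_subspaceT _ _ `[t0, t] E) => {}s.
      by apply: differentiable_continuous; apply/derivable1_diffP; have [] := dE s.
  - by rewrite in_itv/= lexx t0t.
  - by rewrite in_itv/= lexx t0t.
have E0 : 0 < E t by exact: expR_gt0.
rewrite mulNr expRN -/(E t) ler_pdivlMr//.
by move: wle; rewrite /w/= {2}/E subrr mulr0 expR0 mulr1.
Qed.

(** * Quadratic Lyapunov functions by cascade *)

Section Lyapunov.
Variables (R : realType) (V : normedModType R) (F : V -> V).
Implicit Types (f g df dg q : V -> R).

(** [df] is the Lie derivative of [f] along [F], defined through curves so that [f] itself need not
    be differentiated on [V]. *)
Definition flow f df : Prop :=
  forall (y : R -> V) (t : R), is_derive t (1 : R) y (F (y t)) ->
    is_derive t (1 : R) (f \o y) (df (y t)).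

(** Only semidefinite: [q] may vanish away from 0. A cascade enlarges [q] step by step, and
    [dominated] records which signals it already controls. *)
Definition lyapunov q : Prop :=
  [/\ continuous q, q 0 = 0, forall y, 0 <= q y &
    exists c dq, [/\ 0 < c, flow q dq & forall y, dq y <= - c * q y]].

Definition dominated q f : Prop := exists K, forall y, f y ^+ 2 <= K * q y.

Lemma flowD f g df dg :
  flow f df -> flow g dg -> flow (f \+ g) (df \+ dg).
Proof.
by move=> fP gP y t yt; have := fP y t yt; have := gP y t yt => ? ?; exact: is_deriveD.
Qed.

Lemma flowZ k f df : flow f df -> flow (k \*o f) (k \*o df).
Proof. by move=> fP y t yt; have := fP y t yt => ?; exact: is_deriveZ. Qed.

Lemma flow_sqr f df :
  flow f df -> flow (fun y => f y ^+ 2) (fun y => 2 * f y * df y).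
Proof.
move=> fP y t yt; have ft := fP y t yt.
rewrite (_ : _ \o y = (f \o y) * (f \o y)); last first.
  by apply/funext => s; rewrite /= expr2.
by apply: is_derive_eq; rewrite /GRing.scale/= -mulrA mulr_natl mulr2n.
Qed.

Lemma continuous_sqr f : continuous f -> continuous (fun y => f y ^+ 2).
Proof. by move=> cf y; apply: continuousM; exact: cf. Qed.

Lemma dominatedD q f g :
  dominated q f -> dominated q g -> dominated q (f \+ g).
Proof.
move=> [K fK] [L gL]; exists (2 * (K + L)) => y.
have := fK y; have := gL y; have := sqr_ge0 (f y - g y) => /=; nra.
Qed.

Lemma dominatedZ k q f : dominated q f -> dominated q (k \*o f).
Proof.
move=> [K fK]; exists (k ^+ 2 * K) => y /=.
by rewrite exprMn -mulrA ler_wpM2l ?sqr_ge0.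
Qed.

(** On an explicit list the [foldr] computes to a chain of conjunctions, so that a use only has to
    split and then check one algebraic identity. *)
Lemma dominated_comb q (s : seq (R * (V -> R))) f :
  foldr (fun x P => dominated q x.2 /\ P) (dominated q (fun=> 0)) s ->
  (forall y, f y = \sum_(x <- s) x.1 * x.2 y) -> dominated q f.
Proof.
move=> + /funext ->; elim: s => [|[a g] s IH] /= => [|[qg /IH qs]].
  by rewrite (_ : (fun _ => _) = fun=> 0)//; apply/funext => y; rewrite big_nil.
rewrite (_ : (fun _ => _) =
    (a \*o g) \+ (fun y => \sum_(x <- s) x.1 * x.2 y)); last first.
  by apply/funext => y; rewrite big_cons.
exact/dominatedD/qs/dominatedZ.
Qed.

Lemma dominated0 q : (forall y, 0 <= q y) -> dominated q (fun=> 0).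
Proof. by move=> q0; exists 1 => y; rewrite expr0n/= mul1r. Qed.

Lemma lyapunov0 : lyapunov (fun=> 0).
Proof.
split => //; first by move=> ?; exact: cvg_cst.
exists 1, (fun=> 0); split => [//|y t _|y]; last by rewrite mulr0.
exact: (is_derive_cst 0).
Qed.

(* A subsystem with energy [E] driven by a signal [g] that already decays:
   the Lyapunov function is E + k q with k large. *)
Lemma lyapunov_cascade q (E dE g : V -> R) (a b : R) :
  lyapunov q -> dominated q g ->
  continuous E -> E 0 = 0 -> (forall y, 0 <= E y) -> flow E dE ->
  0 < a -> 0 <= b -> (forall y, dE y <= - a * E y + b * g y ^+ 2) ->
  exists q', [/\ lyapunov q', forall y, E y <= q' y &
    forall f, dominated q f -> dominated q' f].
Proof.
move=> [cq q00 q0 [c [dq [c0 fq dqle]]]] [L gL] cE E00 E0 fE a0 b0 dEle.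
(* Half of the decay of [k q], namely k c q / 2, absorbs the input term, at most b |L| q; the other
   half gives the rate c / 2. The summand 1 makes [k q] at least [q]. *)
pose k := 1 + 2 * b * `|L| / c.
have k1 : 1 <= k by rewrite lerDl divr_ge0 ?(ltW c0)// !mulr_ge0.
have k0 : 0 < k by exact: lt_le_trans k1.
exists (E \+ (k \*o q)); split.
- split.
  + move=> y; apply: continuousD; first exact: cE.
    by apply: continuousM; [exact: cvg_cst | exact: cq].
  + by rewrite /= E00 q00 mulr0 addr0.
  + by move=> y; rewrite addr_ge0// mulr_ge0// ltW.
  + exists (Num.min a (c / 2)), (dE \+ (k \*o dq)); split.
    * by rewrite lt_min a0 divr_gt0.
    * exact/flowD/flowZ.
    * move=> y /=.
      have h1 : dE y <= - a * E y + b * `|L| * q y.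
        apply: le_trans (dEle y) _; rewrite lerD2l -mulrA ler_wpM2l//.
        by apply: le_trans (gL y) _; rewrite ler_wpM2r// ler_norm.
      have h2 : k * dq y <= k * (- c * q y) by rewrite ler_pM2l.
      have h3 : b * `|L| <= k * c / 2.
        have kc : k * c = c + 2 * (b * `|L|) by rewrite /k; field; rewrite gt_eqF.
        by rewrite kc; lra.
      have h4 := ler_wpM2r (q0 y) h3.
      have h5 : Num.min a (c / 2) * E y <= a * E y by rewrite ler_wpM2r ?ge_min ?lexx.
      have h6 : Num.min a (c / 2) * (k * q y) <= c / 2 * (k * q y).
        by rewrite ler_wpM2r ?ge_min ?lexx ?orbT// mulr_ge0// ltW.
      lra.
- by move=> y; rewrite lerDl mulr_ge0// ltW.
- move=> f [K fK]; exists `|K| => y /=.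
  apply: (le_trans (fK y)); apply: (@le_trans _ _ (`|K| * q y)).
    by rewrite ler_wpM2r// ler_norm.
  rewrite ler_wpM2l//; apply: (@le_trans _ _ (k * q y)); last by rewrite lerDr.
  by rewrite ler_peMl.
Qed.

(** The energy is f^2. Young's inequality 2 f g <= a f^2 + g^2 / a spends half of the damping 2 a
    f^2 on the input. *)
Lemma lyapunov_scalar q f g (a : R) :
  lyapunov q -> dominated q g -> continuous f -> f 0 = 0 -> 0 < a ->
  flow f (fun y => - a * f y + g y) ->
  exists q', [/\ lyapunov q', dominated q' f &
    forall h, dominated q h -> dominated q' h].
Proof.
move=> lq qg cf f0 a0 /flow_sqr fE.
have [||||y|q' [lq' fq' qq']] := lyapunov_cascade lq qg _ _ _ fE a0 (b := a^-1).
- exact: continuous_sqr.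
- by rewrite f0 expr0n.
- by move=> y; exact: sqr_ge0.
- by rewrite invr_ge0 ltW.
- have := sqr_ge0 (a * f y - g y) => h.
  have : 0 <= a^-1 * (a * f y - g y) ^+ 2 by rewrite mulr_ge0// invr_ge0 ltW.
  rewrite (_ : a^-1 * _ = a * f y ^+ 2 - 2 * f y * g y + a^-1 * g y ^+ 2).
    lra.
  by field; rewrite gt_eqF.
- by exists q'; split => //; exists 1 => y; rewrite mul1r.
Qed.

(* The equations of a boost converter loop: E is twice its stored energy. *)
Lemma lyapunov_converter q (x b i g : V -> R) (Ca Cb L Ra Rb d r : R) :
  lyapunov q -> dominated q g ->
  continuous x -> continuous b -> continuous i ->
  x 0 = 0 -> b 0 = 0 -> i 0 = 0 ->
  0 < Ca -> 0 < Cb -> 0 < L -> 0 < Ra -> 0 < Rb -> 0 < r ->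
  flow x (fun y => (- x y / Ra - i y) / Ca) ->
  flow b (fun y => ((g y - b y) / Rb + d * i y) / Cb) ->
  flow i (fun y => (x y - d * b y - r * i y) / L) ->
  exists q', [/\ lyapunov q', dominated q' x, dominated q' b, dominated q' i &
    forall h, dominated q h -> dominated q' h].
Proof.
move=> lq qg cx cb ci x0 b0 i0 Ca0 Cb0 L0 Ra0 Rb0 r0 fx fb fi.
pose E := (Ca \*o (fun y => x y ^+ 2)) \+ ((Cb \*o (fun y => b y ^+ 2))
  \+ (L \*o (fun y => i y ^+ 2))).
(* Ratios of dissipation to energy in the three components. The one for [b] is halved, since the
   other half of its damping pays for the input [g]. *)
pose m := Num.min (2 / (Ra * Ca)) (Num.min (1 / (Rb * Cb)) (2 * r / L)).
have m0 : 0 < m by rewrite !lt_min !divr_gt0 ?mulr_gt0.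
have fE := flowD (flowZ Ca (flow_sqr fx))
  (flowD (flowZ Cb (flow_sqr fb)) (flowZ L (flow_sqr fi))).
have cE : continuous E.
  move=> y; apply: continuousD; last apply: continuousD.
  - by apply: continuousM; [exact: cvg_cst | exact: continuous_sqr].
  - by apply: continuousM; [exact: cvg_cst | exact: continuous_sqr].
  - by apply: continuousM; [exact: cvg_cst | exact: continuous_sqr].
have E0 y : 0 <= E y.
  by rewrite !addr_ge0// mulr_ge0 ?sqr_ge0// ltW.
have [||y|q' [lq' Eq' qq']] := lyapunov_cascade lq qg cE _ E0 fE m0 (b := Rb^-1).
- by rewrite /E/= x0 b0 i0 !expr0n/= !mulr0 !addr0.
- by rewrite invr_ge0 ltW.
- have h1 : m * (Ca * x y ^+ 2) <= 2 / Ra * x y ^+ 2.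
    rewrite mulrA ler_wpM2r ?sqr_ge0// -ler_pdivlMr//.
    by rewrite (_ : _ / Ca = 2 / (Ra * Ca)) ?ge_min ?lexx//; field; rewrite !gt_eqF.
  have h2 : m * (Cb * b y ^+ 2) <= 1 / Rb * b y ^+ 2.
    rewrite mulrA ler_wpM2r ?sqr_ge0// -ler_pdivlMr//.
    rewrite (_ : _ / Cb = 1 / (Rb * Cb)) ?ge_min ?lexx ?orbT//.
    by field; rewrite !gt_eqF.
  have h3 : m * (L * i y ^+ 2) <= 2 * r * i y ^+ 2.
    rewrite mulrA ler_wpM2r ?sqr_ge0// -ler_pdivlMr//.
    by rewrite ge_min ge_min lexx !orbT.
  have h4 : 0 <= Rb^-1 * (b y - g y) ^+ 2.
    by rewrite mulr_ge0 ?sqr_ge0// invr_ge0 ltW.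
  (* The exchange terms between [i] and [x] and between [i] and [b] cancel, whatever the sign of
     [d]; completing the square handles 2 b g / Rb. *)
  rewrite [leLHS](_ : _ = - (2 / Ra * x y ^+ 2) - 2 * r * i y ^+ 2
      - 1 / Rb * b y ^+ 2 - Rb^-1 * (b y - g y) ^+ 2 + Rb^-1 * g y ^+ 2).
    rewrite /E /=; lra.
  by rewrite /=; field; rewrite !gt_eqF.
have part k f : 0 < k -> (forall y, k * f y ^+ 2 <= E y) -> dominated q' f.
  move=> k0 fEle; exists k^-1 => y; rewrite -ler_pdivrMl ?invr_gt0// invrK.
  exact: le_trans (fEle y) (Eq' y).
exists q'; split => //.
- apply: (part _ _ Ca0) => y; rewrite lerDl addr_ge0// mulr_ge0 ?sqr_ge0// ltW//.
- apply: (part _ _ Cb0) => y; rewrite /E/= addrCA lerDl addr_ge0// mulr_ge0 ?sqr_ge0// ltW//.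
- apply: (part _ _ L0) => y; rewrite /E/= addrA lerDr addr_ge0// mulr_ge0 ?sqr_ge0// ltW//.
Qed.

End Lyapunov.

(** * Linear forms and stabilization along a Krylov chain *)

Lemma flow_coord (R : realType) (n : nat) (F : 'rV[R]_n -> 'rV[R]_n) (i : 'I_n) :
  flow F (fun y => y ord0 i) (fun y => F y ord0 i).
Proof. by move=> y t /is_derive_mxP; exact. Qed.

Definition lform (R : realType) (n : nat) (f : 'cV[R]_n) (y : 'rV[R]_n) : R :=
  (y *m f) ord0 ord0.

Lemma lform_continuous (R : realType) (n : nat) (f : 'cV[R]_n) :
  continuous (lform f).
Proof.
rewrite (_ : lform f = fun y : 'rV_n => \sum_i y ord0 i * f i ord0).
  apply: continuous_big => [|i _ y]; first exact: add_continuous.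
  by apply: (@cvgMr_tmp _ _ (nbhs y)); exact: coord_continuous.
by apply/funext => y; rewrite /lform mxE.
Qed.

Lemma flow_lform (R : realType) (n : nat) (A : 'M[R]_n) (f : 'cV[R]_n) :
  flow (mulmx^~ A) (lform f) (lform (A *m f)).
Proof.
move=> y t yt; rewrite /lform mulmxA mxE.
rewrite (_ : _ \o y =
    \sum_i (f i ord0 \*o ((fun v : 'rV_n => v ord0 i) \o y))); last first.
  by apply/funext => s; rewrite /= /lform mxE fct_sumE; apply: eq_bigr => i _; rewrite mulrC.
have dyi i := @flow_coord R n (mulmx^~ A) i y t yt.
apply: is_derive_eq; apply: eq_bigr => i _.
by rewrite /GRing.scale/= mulrC.
Qed.

(* The gain [k] cancels the last step of the Krylov chain of [c]:
   z_j = (A + 1)^j c satisfies z_j' = - z_j + z_{j+1} for j < m and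
   z_m' = - z_m. *)
Lemma krylov_stabilization (R : realType) (n m : nat) (A : 'M[R]_n)
    (b : 'rV[R]_n) (c : 'cV[R]_n) :
  let z j := iter j (mulmx (A + 1%:M)) c in
  (forall j, (j < m)%N -> lform (z j) b = 0) ->
  lform (z m) b != 0 ->
  exists k : 'cV[R]_n, exists q, lyapunov (mulmx^~ (A + k *m b)) q /\
    forall j, (j <= m)%N -> dominated q (lform (z j)).
Proof.
move=> z zb0 zbm; set beta := lform (z m) b in zbm.
have zS j : z j.+1 = A *m z j + z j by rewrite /z iterS mulmxDl mul1mx.
pose k := - beta^-1 *: z m.+1; exists k; set Ak := A + k *m b.
have bz j : k *m b *m z j = lform (z j) b *: k.
  by rewrite -mulmxA [b *m z j]mx11_scalar mul_mx_scalar.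
have Az j : (j < m)%N -> Ak *m z j = z j.+1 - z j.
  by move=> jm; rewrite mulmxDl bz zb0// scale0r addr0 zS addrK.
have Azm : Ak *m z m = - z m.
  rewrite mulmxDl bz -/beta /k scalerA mulrN divff// scaleN1r zS opprD.
  by rewrite addrA subrr add0r.
(* Induction from the end of the chain: z_m decays by itself, and each earlier form is a scalar
   equation driven by its successor. *)
suff H d : (d <= m)%N -> exists q, lyapunov (mulmx^~ Ak) q /\
    forall j, (m - d <= j <= m)%N -> dominated q (lform (z j)).
  have [q [lq qz]] := H m (leqnn m); exists q; split => // j jm.
  by apply: qz; rewrite subnn.
elim: d => [_|d IH dm].
  have q0 : forall y : 'rV[R]_n, 0 <= (fun=> 0 : R) y by [].
  have [||q [lq qz _]] := lyapunov_scalar (lyapunov0 (mulmx^~ Ak)) (dominated0 q0)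
    (@lform_continuous _ _ (z m)) _ ltr01.
  - by rewrite /lform mul0mx mxE.
  - move=> y t yt; have := flow_lform (z m) yt.
    by rewrite Azm /lform mulmxN mxE mulN1r addr0.
  - exists q; split => // j; rewrite subn0 -eqn_leq => /eqP <-//.
have [q [lq qz]] := IH (ltnW dm).
have mdm : (m - d.+1 < m)%N by rewrite ltn_subrL/= (leq_ltn_trans _ dm).
have mdS : (m - d.+1).+1 = (m - d)%N by rewrite -subSn.
have [|||q' [lq' qz' qq']] := lyapunov_scalar lq (qz (m - d)%N _)
    (@lform_continuous _ _ (z (m - d.+1)%N)) _ ltr01.
- by rewrite leqnn leq_subr.
- by rewrite /lform mul0mx mxE.
- move=> y t yt; have := flow_lform (z (m - d.+1)%N) yt.
  rewrite Az// mdS; congr is_derive.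
  by rewrite /lform mulmxBr [LHS]mxE [X in _ + X]mxE mulN1r addrC.
- exists q'; split => // j /andP[mdj jm].
  have [<-//|mj] := eqVneq (m - d.+1)%N j.
  by apply/qq'/qz; rewrite jm andbT -mdS ltn_neqAle mj.
Qed.

(** * The linearized microgrid *)

Section Entries.
Variables (R : realType) (n : nat).
Implicit Types (u v : 'rV[R]_n.+1) (k : nat).

Lemma entryD u v k : entry (u + v) k = entry u k + entry v k.
Proof. by rewrite /entry mxE. Qed.

Lemma entryN u k : entry (- u) k = - entry u k.
Proof. by rewrite /entry mxE. Qed.

Lemma entryZ a u k : entry (a *: u) k = a * entry u k.
Proof. by rewrite /entry mxE. Qed.

Lemma entry0 k : entry (0 : 'rV[R]_n.+1) k = 0.
Proof. by rewrite /entry mxE. Qed.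

Lemma entry_vec (s : seq R) k : (k.-1 <= n)%N -> entry (vec n.+1 s) k = s`_k.-1.
Proof. by move=> kn; rewrite /entry mxE inordK. Qed.

Lemma entry_delta i k : (i.-1 <= n)%N -> (k.-1 <= n)%N ->
  entry (delta_mx ord0 (inord i.-1) : 'rV[R]_n.+1) k = (k.-1 == i.-1)%:R.
Proof.
move=> ilt klt; rewrite /entry mxE eqxx/=; congr (_%:R).
by rewrite -val_eqE/= !inordK.
Qed.

Lemma entryP u v :
  (forall k, (0 < k <= n.+1)%N -> entry u k = entry v k) -> u = v.
Proof.
move=> uv; apply/rowP => i; have := uv i.+1; rewrite /entry/= inord_val.
by apply; exact: ltn_ord.
Qed.

Lemma entry_continuous k : continuous (fun u => entry u k).
Proof. exact: coord_continuous. Qed.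

End Entries.

Lemma forall_1_to_12 (P : nat -> Prop) :
  P 1%N -> P 2 -> P 3 -> P 4 -> P 5 -> P 6 -> P 7 -> P 8 -> P 9 -> P 10 ->
  P 11 -> P 12 -> forall k, (0 < k <= 12)%N -> P k.
Proof. by move=> ? ? ? ? ? ? ? ? ? ? ? ?; do 13 case=> //. Qed.

Definition boost_resistance (R : realType) (p : microgrid R) (d : R) : R :=
  R01 p * d + R02 p * (1 - d).

(* Closed-loop dynamics of y = (deviations of x1, ..., x10, x11 / x10,
   x12 / x10) for constant 1 - u1 = d and 1 - u2 = d', and V_S u3 = x9*. *)
Definition drift (R : realType) (p : microgrid R) (d d' : R) (y : 'rV[R]_12) :
    'rV[R]_12 :=
  let y1 := entry y 1 in let y2 := entry y 2 in let y3 := entry y 3 in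
  let y4 := entry y 4 in let y5 := entry y 5 in let y6 := entry y 6 in
  let y7 := entry y 7 in let y8 := entry y 8 in let y9 := entry y 9 in
  let y10 := entry y 10 in let y11 := entry y 11 in let y12 := entry y 12 in
  vec 12 [::
    (- y1 / R1 p - y3) / C1 p;
    ((y9 - y2) / R2 p + d * y3) / C2 p;
    (y1 - d * y2 - boost_resistance p d * y3) / L3 p;
    (- y4 / R4 p - y6) / C4 p;
    ((y9 - y5) / R5 p + d' * y6) / C5 p;
    (y4 - d' * y5 - R04 p * y6) / L6 p;
    ((y9 - y7) / R7 p - y8) / C7 p;
    (- R08 p * y8 - y7) / L8 p;
    ((y2 - y9) / R2 p + (y5 - y9) / R5 p + (y7 - y9) / R7 p
      + (y10 - y9) / R10 p - y9 / RL p) / C9 p;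
    (- (3 / 2) * (vld p * y11 + vlq p * y12) + (y9 - y10) / R10 p) / C10 p;
    - y11;
    - y12].

Definition unit_row (R : realType) (k : nat) : 'rV[R]_12 :=
  delta_mx ord0 (inord k.-1).

(** * Reachability from x8 and stabilization of the linear system *)

Section Stabilization.
Variables (R : realType) (p : microgrid R) (d d' : R).
Hypothesis p_phys : physical p.

Local Notation D := (drift p d d').

Let drift_linear : linear D.
Proof.
move=> a u v; apply: entryP; apply: forall_1_to_12;
  rewrite /drift !(entryD, entryZ, entry_vec)//=; ring.
Qed.

HB.instance Definition _ :=
  GRing.isLinear.Build R 'rV[R]_12 'rV[R]_12 *:%R D drift_linear.

Definition drift_mx : 'M[R]_12 := lin1_mx D.

Lemma mul_drift_mx y : y *m drift_mx = D y.
Proof. exact: mul_rV_lin1. Qed.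

Local Notation e := (@unit_row R).

Definition drift_step (y : 'rV[R]_12) : 'rV[R]_12 := D y + y.
Local Notation G := drift_step.

(** By transposition, the Krylov forms of a coordinate are that coordinate read along the iterates
    of [G], so they can be computed from the circuit equations. *)
Let krylov_entry k j y :
  lform (iter j (mulmx (drift_mx + 1%:M)) (e k)^T) y = entry (iter j G y) k.
Proof.
elim: j y => [|j IH] y; last first.
  by rewrite [in RHS]iterSr -IH /lform iterS mulmxA mulmxDr mulmx1 mul_drift_mx.
rewrite /lform /unit_row /entry trmx_delta mxE (bigD1 (inord k.-1))//= mxE !eqxx mulr1.
by rewrite big1 ?addr0// => i /negPf ik; rewrite mxE ik/= mulr0.
Qed.


Let G_entry y k : entry (G y) k = entry (D y) k + entry y k.
Proof. exact: entryD. Qed.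

(** Orbit of the input direction. It enters x7 at step 1 and x9 at step 2, then passes through x2
    and x3 to reach x1 at step 5 when d <> 0. The first nonzero entry at a coordinate gives the
    relative degree of that coordinate. *)
Let r j := iter j G (e 8).

Let rS j k : entry (r j.+1) k = entry (D (r j)) k + entry (r j) k.
Proof. exact: G_entry. Qed.

Let pos : [/\ 0 < C1 p, 0 < C2 p, 0 < C7 p & 0 < C9 p] /\
  [/\ 0 < R1 p, 0 < R2 p, 0 < R7 p & 0 < L3 p].
Proof. by case: p_phys => [[? ? ? ?] [? ? ?] [[? ? ? ?] [? ? ? ?]] [[? ? ? ?] [? ? ? ?]] _]. Qed.

Let r0E k : (k.-1 < 12)%N -> entry (r 0) k = (k.-1 == 7)%:R.
Proof. by move=> k12; rewrite entry_delta. Qed.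

Let r1E : [/\ entry (r 1) 1 = 0, entry (r 1) 2 = 0, entry (r 1) 3 = 0 &
  entry (r 1) 5 = 0] /\
  [/\ entry (r 1) 9 = 0, entry (r 1) 10 = 0 & entry (r 1) 7 != 0].
Proof.
have [[? ? ? ?] [? ? ? ?]] := pos.
rewrite !(rS 0) /drift !entry_vec//= !r0E//=.
rewrite !(mulr0, mul0r, subr0, addr0, oppr0) sub0r.
by rewrite mulf_neq0// ?oppr_eq0 ?oner_eq0// invr_eq0 gt_eqF.
Qed.

Let r2E : [/\ entry (r 2) 1 = 0, entry (r 2) 2 = 0, entry (r 2) 3 = 0 &
  entry (r 2) 9 != 0].
Proof.
have [[? ? ? ?] [? ? ? ?]] := pos.
have [[e1 e2 e3 e5] [e9 e10 e7]] := r1E.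
rewrite !(rS 1) /drift !entry_vec//= e1 e2 e3 e5 e9 e10.
rewrite !(mulr0, mul0r, subr0, addr0, add0r, oppr0).
by rewrite !mulf_neq0// invr_eq0 gt_eqF.
Qed.

(** x2 becomes nonzero at step 3, x3 at step 4 and x1 at step 5. The passage from x2 to x3 carries
    the factor [d]. *)
Let r5E : d != 0 -> [/\ entry (r 3) 1 = 0, entry (r 4) 1 = 0 & entry (r 5) 1 != 0].
Proof.
have [[? ? ? ?] [? ? ? ?]] := pos => d0.
have [e1 e2 e3 e9] := r2E.
have [f1 f3 f2] : [/\ entry (r 3) 1 = 0, entry (r 3) 3 = 0 & entry (r 3) 2 != 0].
  rewrite !(rS 2) /drift !entry_vec//= e1 e2 e3.
  rewrite !(mulr0, mul0r, subr0, addr0, add0r, oppr0).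
  by rewrite !mulf_neq0// invr_eq0 gt_eqF.
have [g1 g3] : entry (r 4) 1 = 0 /\ entry (r 4) 3 != 0.
  rewrite !(rS 3) /drift !entry_vec//= f1 f3.
  rewrite !(mulr0, mul0r, subr0, addr0, add0r, oppr0).
  by rewrite !mulf_neq0// ?oppr_eq0 ?mulf_neq0// invr_eq0 gt_eqF.
split=> //.
rewrite !(rS 4) /drift !entry_vec//= g1.
rewrite !(mulr0, mul0r, subr0, addr0, add0r, oppr0).
by rewrite !mulf_neq0// ?oppr_eq0// invr_eq0 gt_eqF.
Qed.

(** Relative degree 2. The iterates of [G] are those of the open loop; up to this index the input
    has not entered the ninth entry, so the closed loop gives the same forms. *)
Lemma chain_from_x9 : exists k : 'cV[R]_12, exists q,
  lyapunov (mulmx^~ (drift_mx + k *m e 8)) q /\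
  forall j, (j <= 2)%N -> dominated q (fun y => entry (iter j G y) 9).
Proof.
have [_ _ _ e9] := r2E; have [_ [f9 _ _]] := r1E.
have [||k [q [lq qz]]] := @krylov_stabilization R 12 2 drift_mx (e 8) (e 9)^T.
- by move=> [|[|//]] _; rewrite krylov_entry//= entry_delta.
- by rewrite krylov_entry.
- exists k, q; split => // j /qz [K qK].
  by exists K => y; rewrite -krylov_entry.
Qed.

Lemma chain_from_x1 : d != 0 -> exists k : 'cV[R]_12, exists q,
  lyapunov (mulmx^~ (drift_mx + k *m e 8)) q /\
  forall j, (j <= 5)%N -> dominated q (fun y => entry (iter j G y) 1).
Proof.
move=> d0; have [h1 g1 i1] := r5E d0.
have [e1 _ _ _] := r2E; have [[f1 _ _ _] _] := r1E.
have [||k [q [lq qz]]] := @krylov_stabilization R 12 5 drift_mx (e 8) (e 1)^T.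
- move=> j; rewrite krylov_entry; case: j => [_|]; first exact: r0E.
  by do 4 (case=> //).
- by rewrite krylov_entry.
- exists k, q; split => // j /qz [K qK].
  by exists K => y; rewrite -krylov_entry.
Qed.


Lemma entry_closed_mx (k : 'cV[R]_12) y j :
  entry (y *m (drift_mx + k *m e 8)) j =
  entry (D y) j + lform k y * entry (e 8) j.
Proof.
rewrite mulmxDr mul_drift_mx mulmxA [y *m k]mx11_scalar mul_scalar_mx.
by rewrite entryD entryZ.
Qed.

(** The gain acts on the eighth coordinate only, so all other equations are those of the drift. *)
Let flow_entry (k : 'cV[R]_12) j : (0 < j <= 12)%N -> j != 8 ->
  flow (mulmx^~ (drift_mx + k *m e 8)) (fun y => entry y j)
    (fun y => entry (D y) j).
Proof.
move=> /andP[j0 j12] j8 y t yt.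
have -> : entry (D (y t)) j = entry (y t *m (drift_mx + k *m e 8)) j.
  rewrite entry_closed_mx entry_delta//; last by rewrite -ltnS prednK.
  by move: j8; rewrite -(prednK j0) eqSS => /negPf ->; rewrite mulr0 addr0.
exact: (@flow_coord _ _ (mulmx^~ (drift_mx + k *m e 8)) _ y t yt).
Qed.

(** The decaying x9 drives the loop (x4, x5, x6); the current ratios decay on their own; together
    they drive x10. Then x7 and x8 need no further energy: the x9-equation gives x7, and the
    x7-equation gives x8, as combinations of controlled signals. *)
Lemma lyapunov_from_x9 (k : 'cV[R]_12) q :
  lyapunov (mulmx^~ (drift_mx + k *m e 8)) q ->
  (forall j, (j <= 2)%N -> dominated q (fun y => entry (iter j G y) 9)) ->
  dominated q (fun y => entry y 2) -> dominated q (fun y => entry y 3) ->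
  exists q', [/\ lyapunov (mulmx^~ (drift_mx + k *m e 8)) q',
    forall f, dominated q f -> dominated q' f &
    forall j, (4 <= j <= 12)%N -> dominated q' (fun y => entry y j)].
Proof.
move=> lq qz qe2 qe3.
have := p_phys => -[[? ? ? ?] [? ? ?] [[? ? ? ?] [? ? ? ?]] [[? ? ? ?] [? ? ? ?]] _].
have D0 : dominated q (fun=> 0) by apply: dominated0; case: lq.

have [|||q1 [lq1 q14 q15 q16 qq1]] := lyapunov_converter
    (x := fun y => entry y 4) (b := fun y => entry y 5) (i := fun y => entry y 6)
    (g := fun y => entry y 9) (Ca := C4 p) (Cb := C5 p) (L := L6 p)
    (Ra := R4 p) (Rb := R5 p) (d := d') (r := R04 p) lq (qz 0 isT)
    (@entry_continuous _ _ 4) (@entry_continuous _ _ 5)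
    (@entry_continuous _ _ 6) (entry0 _ _ _) (entry0 _ _ _) (entry0 _ _ _)
    ltac:(by []) ltac:(by []) ltac:(by []) ltac:(by []) ltac:(by []) ltac:(by []).
- by move=> y t /flow_entry -/(_ 4 isT isT); rewrite /drift entry_vec.
- by move=> y t /flow_entry -/(_ 5 isT isT); rewrite /drift entry_vec.
- by move=> y t /flow_entry -/(_ 6 isT isT); rewrite /drift entry_vec.
have [||q2 [lq2 q211 qq2]] := lyapunov_scalar (f := fun y => entry y 11)
    lq1 (qq1 _ D0) (@entry_continuous _ _ 11) _ ltr01.
- exact: entry0.
- move=> y t /flow_entry -/(_ 11 isT isT); rewrite /drift entry_vec//=.
  by rewrite mulN1r addr0.
have [||q3 [lq3 q312 qq3]] := lyapunov_scalar (f := fun y => entry y 12)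
    lq2 (qq2 _ (qq1 _ D0)) (@entry_continuous _ _ 12) _ ltr01.
- exact: entry0.
- move=> y t /flow_entry -/(_ 12 isT isT); rewrite /drift entry_vec//=.
  by rewrite mulN1r addr0.
have D9 := qz 0 isT.
(* The input of the x10-equation once its own damping term is set apart. *)
pose g (y : 'rV[R]_12) := - (3 / 2) * vld p / C10 p * entry y 11
  - (3 / 2) * vlq p / C10 p * entry y 12 + (R10 p * C10 p)^-1 * entry y 9.
have q3g : dominated q3 g.
  apply: (dominated_comb (s := [:: (- (3 / 2) * vld p / C10 p, fun y => entry y 11);
      (- (3 / 2) * vlq p / C10 p, fun y => entry y 12);
      ((R10 p * C10 p)^-1, fun y => entry y 9)])) => [|y].
    by split; [exact: qq3 | split => //; split; apply/qq3/qq2/qq1].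
  by rewrite !big_cons big_nil /g/= addr0 addrA !mulNr.
have [|||q4 [lq4 q410 qq4]] := lyapunov_scalar (f := fun y => entry y 10)
    (a := (R10 p * C10 p)^-1) lq3 q3g (@entry_continuous _ _ 10).
- exact: entry0.
- by rewrite invr_gt0 mulr_gt0.
- move=> y t /flow_entry -/(_ 10 isT isT); rewrite /drift entry_vec//=.
  set dy := (X in is_derive _ _ _ X -> _); set dy' := (X in _ -> is_derive _ _ _ X).
  suff -> : dy = dy' by [].
  by rewrite /dy /dy' /g; field; rewrite !gt_eqF.
have up f : dominated q f -> dominated q4 f by move=> ?; exact/qq4/qq3/qq2/qq1.
have q411 : dominated q4 (fun y => entry y 11) by exact/qq4/qq3.
have q412 : dominated q4 (fun y => entry y 12) by exact: qq4.
have q45 : dominated q4 (fun y => entry y 5) by exact/qq4/qq3/qq2.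
have q46 : dominated q4 (fun y => entry y 6) by exact/qq4/qq3/qq2.
have q44 : dominated q4 (fun y => entry y 4) by exact/qq4/qq3/qq2.
have q49 := up _ (qz 0 isT); have q49' := up _ (qz 1 isT).
have q49'' := up _ (qz 2 isT); have q42 := up _ qe2; have q43 := up _ qe3.
have q40 := up _ D0.
(* The x9-equation solved for x7; since [G] adds the identity to the drift, x9 itself is subtracted
   again. *)
have x7E y : entry y 7 = R7 p * C9 p * entry (G y) 9
    - R7 p * C9 p * entry y 9 - R7 p / R2 p * entry y 2 - R7 p / R5 p * entry y 5
    - R7 p / R10 p * entry y 10
    + R7 p * ((R2 p)^-1 + (R5 p)^-1 + (R7 p)^-1 + (R10 p)^-1 + (RL p)^-1) * entry y 9.
  by rewrite G_entry /drift entry_vec//=; field; rewrite !gt_eqF.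
have q47 : dominated q4 (fun y => entry y 7).
  apply: (dominated_comb (s := [:: (R7 p * C9 p, fun y => entry (G y) 9);
     (- (R7 p * C9 p), fun y => entry y 9); (- (R7 p / R2 p), fun y => entry y 2);
     (- (R7 p / R5 p), fun y => entry y 5); (- (R7 p / R10 p), fun y => entry y 10);
     (R7 p * ((R2 p)^-1 + (R5 p)^-1 + (R7 p)^-1 + (R10 p)^-1 + (RL p)^-1),
       fun y => entry y 9)])) => [|y]; first by do ![split=> //].
  by rewrite !big_cons big_nil /= x7E addr0 !addrA !mulNr.
(* To bound x7 one step further, [x7E] is applied at [G y], which calls for the images under [G] of
   x2, x5 and x10. *)
have q42' : dominated q4 (fun y => entry (G y) 2).
  apply: (dominated_comb (s := [:: ((R2 p * C2 p)^-1, fun y => entry y 9);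
     (1 - (R2 p * C2 p)^-1, fun y => entry y 2); (d / C2 p, fun y => entry y 3)]))
     => [|y]; first by do ![split=> //].
  rewrite G_entry /drift entry_vec//= !big_cons big_nil /=.
  by field; rewrite !gt_eqF.
have q45' : dominated q4 (fun y => entry (G y) 5).
  apply: (dominated_comb (s := [:: ((R5 p * C5 p)^-1, fun y => entry y 9);
     (1 - (R5 p * C5 p)^-1, fun y => entry y 5); (d' / C5 p, fun y => entry y 6)]))
     => [|y]; first by do ![split=> //].
  rewrite G_entry /drift entry_vec//= !big_cons big_nil /=.
  by field; rewrite !gt_eqF.
have q410' : dominated q4 (fun y => entry (G y) 10).
  apply: (dominated_comb (s := [:: (1, g);
     (1 - (R10 p * C10 p)^-1, fun y => entry y 10)]))
     => [|y]; first by split; [exact: qq4 | split].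
  rewrite G_entry /drift entry_vec//= !big_cons big_nil /= /g.
  by field; rewrite !gt_eqF.
have q47' : dominated q4 (fun y => entry (G y) 7).
  apply: (dominated_comb (s := [:: (R7 p * C9 p, fun y => entry (G (G y)) 9);
     (- (R7 p * C9 p), fun y => entry (G y) 9);
     (- (R7 p / R2 p), fun y => entry (G y) 2);
     (- (R7 p / R5 p), fun y => entry (G y) 5);
     (- (R7 p / R10 p), fun y => entry (G y) 10);
     (R7 p * ((R2 p)^-1 + (R5 p)^-1 + (R7 p)^-1 + (R10 p)^-1 + (RL p)^-1),
       fun y => entry (G y) 9)])) => [|y]; first by do ![split=> //].
  by rewrite !big_cons big_nil /= x7E addr0 !addrA !mulNr.
(* The x7-equation solved for x8. *)
have q48 : dominated q4 (fun y => entry y 8).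
  apply: (dominated_comb (s := [:: (- C7 p, fun y => entry (G y) 7);
     (C7 p - (R7 p)^-1, fun y => entry y 7); ((R7 p)^-1, fun y => entry y 9)]))
     => [|y]; first by do ![split=> //].
  rewrite !big_cons big_nil /= G_entry /drift entry_vec//=.
  by field; rewrite !gt_eqF.
exists q4; split=> // j.
by do 13 (case: j => [//|j]).
Qed.

Lemma drift_stabilization : d != 0 \/ 0 < boost_resistance p d ->
  exists k : 'cV[R]_12, exists q,
    lyapunov (mulmx^~ (drift_mx + k *m e 8)) q /\
    forall i, dominated q (fun y : 'rV[R]_12 => y ord0 i).
Proof.
move=> d0r.
(* Common target of both cases: exactly the data from which [lyapunov_from_x9] recovers coordinates
   4 to 12, together with the first three. *)
suff [k [q [lq q1 q2 q3 qz]]] : exists k : 'cV[R]_12, exists q,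
    [/\ lyapunov (mulmx^~ (drift_mx + k *m e 8)) q,
      dominated q (fun y => entry y 1), dominated q (fun y => entry y 2),
      dominated q (fun y => entry y 3) &
      forall j, (j <= 2)%N -> dominated q (fun y => entry (iter j G y) 9)].
  have [q' [lq' qq' q'j]] := lyapunov_from_x9 lq qz q2 q3.
  exists k, q'; split => // i.
  suff H j : (0 < j <= 12)%N -> dominated q' (fun y => entry y j).
    have [K qK] := H i.+1 (ltn_ord i).
    by exists K => y; rewrite -[X in y _ X]inord_val; exact: qK.
  case/andP=> j0 j12; have [j4|] := ltnP 3 j; first by apply: q'j; rewrite j4.
  by case: j j0 {j12} => [//|[|[|[|//]]]] _ _; exact: qq'.
have := p_phys => -[[? ? ? ?] [? ? ?] [[? ? ? ?] [? ? ? ?]] [[? ? ? ?] [? ? ? ?]] _].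
have [r0|r0] := boolP (0 < boost_resistance p d).
  have [k [q [lq qz]]] := chain_from_x9.
  have [|||q' [lq' q1 q2 q3 qq]] := lyapunov_converter
      (x := fun y => entry y 1) (b := fun y => entry y 2) (i := fun y => entry y 3)
      (g := fun y => entry y 9) (Ca := C1 p) (Cb := C2 p) (L := L3 p)
      (Ra := R1 p) (Rb := R2 p) (d := d) (r := boost_resistance p d) lq (qz 0 isT)
      (@entry_continuous _ _ 1) (@entry_continuous _ _ 2)
      (@entry_continuous _ _ 3) (entry0 _ _ _) (entry0 _ _ _) (entry0 _ _ _)
      ltac:(by []) ltac:(by []) ltac:(by []) ltac:(by []) ltac:(by []) r0.
  - by move=> y t /flow_entry -/(_ 1 isT isT); rewrite /drift entry_vec.
  - by move=> y t /flow_entry -/(_ 2 isT isT); rewrite /drift entry_vec.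
  - by move=> y t /flow_entry -/(_ 3 isT isT); rewrite /drift entry_vec.
  - by exists k, q'; split => // j /qz; exact: qq.
have d0 : d != 0 by case: d0r => //; move: r0 => /negP.
have [k [q [lq q1]]] := chain_from_x1 d0.
have D0 : dominated q (fun=> 0) by apply: dominated0; case: lq.
(* The loop equations are solved backwards, each at the cost of one iterate: x1 is controlled up to
   index 5, hence x3 up to 4, x2 up to 3 (dividing by [d]) and x9 up to 2. *)
have q3 j : (j <= 4)%N -> dominated q (fun y => entry (iter j G y) 3).
  move=> j4.
  apply: (dominated_comb (s := [:: (C1 p - (R1 p)^-1, fun y => entry (iter j G y) 1);
      (- C1 p, fun y => entry (iter j.+1 G y) 1)])) => [|y].
    by split; [exact/q1/leqW | split => //; exact: q1].
  rewrite !big_cons big_nil /= G_entry /drift entry_vec//=.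
  by field; rewrite !gt_eqF.
have q2 j : (j <= 3)%N -> dominated q (fun y => entry (iter j G y) 2).
  move=> j3.
  apply: (dominated_comb (s := [:: (d^-1, fun y => entry (iter j G y) 1);
      ((L3 p - boost_resistance p d) / d, fun y => entry (iter j G y) 3);
      (- (L3 p / d), fun y => entry (iter j.+1 G y) 3)])) => [|y].
    split; first exact/q1/(leq_trans j3).
    by split; [exact/q3/leqW | split => //; exact: q3].
  rewrite !big_cons big_nil /= G_entry /drift entry_vec//=.
  by field; rewrite d0 gt_eqF.
exists k, q; split => //; [exact: (q1 0)|exact: (q2 0)|exact: (q3 0)|] => j j2.
apply: (dominated_comb (s := [:: (1 - R2 p * C2 p, fun y => entry (iter j G y) 2);
    (- (R2 p * d), fun y => entry (iter j G y) 3);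
    (R2 p * C2 p, fun y => entry (iter j.+1 G y) 2)])) => [|y].
  split; first exact/q2/leqW.
  by split; [exact/q3/(leq_trans j2) | split => //; exact: q2].
rewrite !big_cons big_nil /= G_entry /drift entry_vec//=.
by field; rewrite !gt_eqF.
Qed.

End Stabilization.

(** * Linearizing coordinates and feedback *)

Lemma rV_norm_lt (R : realType) (n : nat) (v : 'rV[R]_n) (r : R) : 0 < r ->
  (forall i, `|v ord0 i| < r) -> `|v| < r.
Proof.
move=> r0 vr; rewrite /Num.Def.normr/= mx_normrE; apply: bigmax_lt => // -[i j] _.
by rewrite ord1; exact: vr.
Qed.

Lemma entry_norm_le (R : realType) (n : nat) (v : 'rV[R]_n.+1) k :
  `|entry v k| <= `|v|.
Proof.
rewrite [leRHS]/Num.Def.normr/= mx_normrE /entry.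
exact: (le_bigmax _ (fun ij => `|v ij.1 ij.2|) (ord0, inord k.-1)).
Qed.

Lemma cvg_entry (R : realType) (n : nat) (T : Type) (F : set_system T)
    {FF : Filter F} (f : T -> 'rV[R]_n.+1) (l : 'rV[R]_n.+1) :
  (forall k, (0 < k <= n.+1)%N -> entry (f x) k @[x --> F] --> entry l k) ->
  f @ F --> l.
Proof.
move=> fl; apply/cvgrPdist_lt => r r0; near=> x.
apply: rV_norm_lt => // i; rewrite !mxE.
move: i; near: x; apply: filter_forall => i.
have := fl i.+1 (ltn_ord i) => /cvgrPdist_lt/(_ r r0).
by rewrite /entry/= inord_val.
Unshelve. all: by end_near. Qed.

Lemma is_derive_entryP (R : realType) (n : nat) (y : R -> 'rV[R]_n.+1) (t : R)
    (dy : 'rV[R]_n.+1) :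
  is_derive t (1 : R) y dy <->
  (forall k, (0 < k <= n.+1)%N ->
    is_derive t (1 : R) (fun s => entry (y s) k) (entry dy k)).
Proof.
split=> [/is_derive_mxP dyk k _|dyk]; first exact: dyk.
apply/is_derive_mxP => i j; rewrite ord1.
by have := dyk j.+1 (ltn_ord j); rewrite /entry/= inord_val.
Qed.

Section Chart.
Variables (R : realType) (xe : 'rV[R]_12).
Hypothesis xe10 : entry xe 10 != 0.

(** The ratios x11 / x10 and x12 / x10 make the term (vld x11 + vlq x12) / x10 of the x10-equation
    linear. *)
Definition chart (x : 'rV[R]_12) : 'rV[R]_12 :=
  let f k := entry x k - entry xe k in
  let g k := entry x k / entry x 10 - entry xe k / entry xe 10 in
  vec 12 [:: f 1; f 2; f 3; f 4; f 5; f 6; f 7; f 8; f 9; f 10; g 11; g 12]%N.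

Definition unchart (y : 'rV[R]_12) : 'rV[R]_12 :=
  let f k := entry y k + entry xe k in
  let g k := f 10 * (entry y k + entry xe k / entry xe 10) in
  vec 12 [:: f 1; f 2; f 3; f 4; f 5; f 6; f 7; f 8; f 9; f 10; g 11; g 12]%N.

Lemma chartK x : entry x 10 != 0 -> unchart (chart x) = x.
Proof.
move=> x10; apply: entryP; apply: forall_1_to_12;
  by rewrite /unchart /chart !entry_vec//= !subrK// mulrC divfK.
Qed.

Lemma unchartK y : entry y 10 + entry xe 10 != 0 -> chart (unchart y) = y.
Proof.
move=> y10; apply: entryP; apply: forall_1_to_12;
  by rewrite /unchart /chart !entry_vec//= ?addrK// mulrC mulKf ?addrK.
Qed.

Lemma chart_xe : chart xe = 0.
Proof.
by apply: entryP; apply: forall_1_to_12; rewrite /chart entry_vec//= subrr entry0.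
Qed.

Lemma unchart0 : unchart 0 = xe.
Proof.
by apply: entryP; apply: forall_1_to_12; rewrite /unchart entry_vec//= !entry0 !add0r// mulrC divfK.
Qed.

Lemma chart_cvg (T : Type) (F : set_system T) {FF : Filter F}
    (f : T -> 'rV[R]_12) x :
  entry x 10 != 0 -> f @ F --> x -> chart (f s) @[s --> F] --> chart x.
Proof.
move=> x10 fx.
have fk k : entry (f s) k @[s --> F] --> entry x k.
  exact: (cvg_comp _ _ fx (@entry_continuous R 11 k x)).
apply: cvg_entry; apply: forall_1_to_12; rewrite /chart entry_vec//=;
  under eq_fun do rewrite entry_vec//=;
  (apply: cvgB; last exact: cvg_cst);
  by [exact: fk | apply: cvgM => //; exact: cvgV].
Qed.

Lemma unchart_cvg (T : Type) (F : set_system T) {FF : Filter F}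
    (f : T -> 'rV[R]_12) y :
  f @ F --> y -> unchart (f s) @[s --> F] --> unchart y.
Proof.
move=> fy.
have fk k c : entry (f s) k + c @[s --> F] --> entry y k + c.
  apply: cvgD; last exact: cvg_cst.
  exact: (cvg_comp _ _ fy (@entry_continuous R 11 k y)).
apply: cvg_entry; apply: forall_1_to_12; rewrite /unchart entry_vec//=;
  under eq_fun do rewrite entry_vec//=;
  by [exact: fk | apply: cvgM; exact: fk].
Qed.

End Chart.

(** * The feedback law and the equations it produces *)

Section Feedback.
Variables (R : realType) (p : microgrid R) (xe : 'rV[R]_12) (u : 'rV[R]_5).
Variable gain : 'cV[R]_12.

(** Right-hand side of the x10-equation. It contains no input, so the feedback may use it as the
    known derivative of x10. *)
Definition dc_link_rate (x : 'rV[R]_12) : R :=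
  - (3 / (2 * C10 p)) * (1 / entry x 10)
    * (vld p * entry x 11 + vlq p * entry x 12)
  + 1 / (R10 p * C10 p) * (entry x 9 - entry x 10).

(* Makes the deviation of x_k / x10 from its reference decay as exp (- t). *)
Definition current_rate (k : nat) (x : 'rV[R]_12) : R :=
  entry x k / entry x 10 * dc_link_rate x
  - entry x 10 * (entry x k / entry x 10 - entry xe k / entry xe 10).

(** The third entry makes V_S u3 equal to the reference of x9 plus [L8 p] times the linear feedback.
    The last two invert the AC current equations, so that x11 and x12 have derivative
    [current_rate]. *)
Definition law (w : R * 'rV[R]_12) : 'rV[R]_5 :=
  let x := w.2 in
  let x10 := entry x 10 in let x11 := entry x 11 in let x12 := entry x 12 in
  vec 5 [::
    entry u 1;
    entry u 2;
    (entry xe 9 + L8 p * lform gain (chart xe x)) / w.1;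
    2 / x10 * (L11 p * current_rate 11 x + R11 p * x11 - omega p * x12 + vld p);
    2 / x10 * (L11 p * current_rate 12 x + R11 p * x12 + omega p * x11 + vlq p)].

Local Notation A :=
  (drift_mx p (1 - entry u 1) (1 - entry u 2) + gain *m unit_row R 8).

Hypotheses (p_phys : physical p) (xe10 : entry xe 10 != 0).
Hypotheses (xe8 : entry xe 8 = 0) (xe79 : entry xe 7 = entry xe 9).
Hypothesis xe_eq : rhs p 1 xe u = 0.

Let rhs_xe k : entry (rhs p 1 xe u) k = 0.
Proof. by rewrite xe_eq entry0. Qed.

(** V_S cancels. The last two equations are the product rule for x_k = x10 (x_k / x10), where the
    ratio evolves by the linear system. *)
Lemma rhs_law vS x : vS != 0 -> entry x 10 != 0 ->
  let X := rhs p vS x (law (vS, x)) in let Y := chart xe x *m A in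
  [/\ forall k, (0 < k <= 10)%N -> entry X k = entry Y k,
    entry X 10 = dc_link_rate x,
    entry X 11 = entry x 10 * entry Y 11 + entry x 11 / entry x 10 * entry X 10 &
    entry X 12 = entry x 10 * entry Y 12 + entry x 12 / entry x 10 * entry X 10].
Proof.
move=> vS0 x10.
have := p_phys => -[[? ? ? ?] [? ? ?] [[? ? ? ?] [? ? ? ?]] [[? ? ? ?] [? ? ? ?]] _].
have X10 : entry (rhs p vS x (law (vS, x))) 10 = dc_link_rate x by rewrite entry_vec.
split => //.
- suff H k : (0 < k <= 12)%N -> (k <= 10)%N ->
      entry (rhs p vS x (law (vS, x))) k = entry (chart xe x *m A) k.
    by move=> j /andP[j0 j10]; apply: H => //; rewrite j0 (leq_trans j10).
  (* Subtracting the equilibrium equations turns a goal into an identity between deviations. They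
     are taken at V_S = 1; the eighth equation, the only one containing V_S, is instead checked
     directly from [xe8] and [xe79]. *)
  have E j : entry (rhs p vS x (law (vS, x))) j =
      entry (rhs p vS x (law (vS, x))) j - entry (rhs p 1 xe u) j.
    by rewrite rhs_xe subr0.
  move: k; apply: forall_1_to_12 => // _; rewrite entry_closed_mx entry_delta//=.
  all: rewrite ?mulr0 ?addr0.
  + by rewrite E /rhs /drift /chart !entry_vec//=; field; rewrite !gt_eqF.
  + by rewrite E /rhs /drift /chart /law !entry_vec//=; field; rewrite !gt_eqF.
  + rewrite E /rhs /drift /chart /law !entry_vec//= /boost_resistance.
    by field; rewrite !gt_eqF.
  + by rewrite E /rhs /drift /chart !entry_vec//=; field; rewrite !gt_eqF.
  + by rewrite E /rhs /drift /chart /law !entry_vec//=; field; rewrite !gt_eqF.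
  + by rewrite E /rhs /drift /chart /law !entry_vec//=; field; rewrite !gt_eqF.
  + by rewrite E /rhs /drift /chart !entry_vec//=; field; rewrite !gt_eqF.
  + rewrite /rhs /drift {2 3}/chart /law !entry_vec//= xe8 xe79.
    by field; rewrite vS0 !gt_eqF.
  + by rewrite E /rhs /drift /chart !entry_vec//=; field; rewrite !gt_eqF.
  + rewrite E /rhs /drift /chart !entry_vec//=.
    by field; rewrite xe10 x10 !gt_eqF.
- rewrite entry_closed_mx entry_delta//= mulr0 addr0 X10.
  rewrite /rhs /drift /law /chart !entry_vec//= /current_rate.
  by field; rewrite x10 xe10 !gt_eqF.
- rewrite entry_closed_mx entry_delta//= mulr0 addr0 X10.
  rewrite /rhs /drift /law /chart !entry_vec//= /current_rate.
  by field; rewrite x10 xe10 !gt_eqF.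
Qed.

End Feedback.

(** * Transfer of solutions between the original and the linearizing coordinates *)

Section Transfer.
Variables (R : realType) (p : microgrid R) (xe : 'rV[R]_12) (u : 'rV[R]_5).
Variable gain : 'cV[R]_12.
Local Notation A :=
  (drift_mx p (1 - entry u 1) (1 - entry u 2) + gain *m unit_row R 8).
Local Notation law := (law p xe u gain).

Hypotheses (p_phys : physical p) (xe10 : entry xe 10 != 0).
Hypotheses (xe8 : entry xe 8 = 0) (xe79 : entry xe 7 = entry xe 9).
Hypothesis xe_eq : rhs p 1 xe u = 0.

Lemma is_derive_chart vS (x : R -> 'rV[R]_12) t :
  vS != 0 -> entry (x t) 10 != 0 ->
  is_derive t (1 : R) x (rhs p vS (x t) (law (vS, x t))) ->
  is_derive t (1 : R) (chart xe \o x) (chart xe (x t) *m A).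
Proof.
move=> vS0 x10 /is_derive_entryP dx.
have [XY X10 X11 X12] := rhs_law gain p_phys xe10 xe8 xe79 xe_eq vS0 x10.
have lin k : (0 < k <= 10)%N ->
    is_derive t (1 : R) (fun s => entry (x s) k - entry xe k)
      (entry (chart xe (x t) *m A) k).
  move=> k10; rewrite -XY// -[X in is_derive _ _ _ X]subr0.
  have dk : is_derive t (1 : R) (fun s => entry (x s) k)
      (entry (rhs p vS (x t) (law (vS, x t))) k).
    by apply: dx; case/andP: k10 => -> /leq_trans->.
  exact: (is_deriveB dk (is_derive_cst (entry xe k) t 1)).
have quo k : (0 < k <= 12)%N ->
    entry (rhs p vS (x t) (law (vS, x t))) k =
      entry (x t) 10 * entry (chart xe (x t) *m A) k
      + entry (x t) k / entry (x t) 10 * entry (rhs p vS (x t) (law (vS, x t))) 10 ->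
    is_derive t (1 : R)
      (fun s => entry (x s) k / entry (x s) 10 - entry xe k / entry xe 10)
      (entry (chart xe (x t) *m A) k).
  move=> k12 Xk.
  have dk := dx k k12; have d10 := dx 10%N isT.
  have dV := is_deriveV x10 d10.
  have dM := is_deriveM dk dV.
  have dc := is_derive_cst (entry xe k / entry xe 10) t (1 : R).
  have := is_deriveB dM dc; set v := (X in is_derive _ _ _ X -> _).
  suff -> : v = entry (chart xe (x t) *m A) k by [].
  rewrite /v subr0 /GRing.scale/= Xk; field; exact: x10.
apply/is_derive_entryP.
apply: (@forall_1_to_12 (fun k => is_derive t (1 : R)
    (fun s => entry (chart xe (x s)) k) (entry (chart xe (x t) *m A) k)));
  rewrite {1}/chart;
  under [X in is_derive _ _ X _]eq_fun do rewrite entry_vec//=.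
all: by [exact: lin | exact: quo].
Qed.

Lemma is_derive_unchart vS (y : R -> 'rV[R]_12) t :
  vS != 0 -> entry (y t) 10 + entry xe 10 != 0 ->
  is_derive t (1 : R) y (y t *m A) ->
  is_derive t (1 : R) (unchart xe \o y)
    (rhs p vS (unchart xe (y t)) (law (vS, unchart xe (y t)))).
Proof.
move=> vS0 y10 /is_derive_entryP dy.
have x10 : entry (unchart xe (y t)) 10 != 0 by rewrite /unchart entry_vec.
have [] := rhs_law gain p_phys xe10 xe8 xe79 xe_eq vS0 x10.
rewrite unchartK// => XY X10 X11 X12.
have lin k : (0 < k <= 10)%N ->
    is_derive t (1 : R) (fun s => entry (y s) k + entry xe k)
      (entry (rhs p vS (unchart xe (y t)) (law (vS, unchart xe (y t)))) k).
  move=> k10; rewrite XY// -[X in is_derive _ _ _ X]addr0.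
  have dk : is_derive t (1 : R) (fun s => entry (y s) k) (entry (y t *m A) k).
    by apply: dy; case/andP: k10 => -> /leq_trans->.
  exact: (is_deriveD dk (is_derive_cst (entry xe k) t 1)).
have pro k : (0 < k <= 12)%N ->
    entry (unchart xe (y t)) k / entry (unchart xe (y t)) 10 =
      entry (y t) k + entry xe k / entry xe 10 ->
    entry (rhs p vS (unchart xe (y t)) (law (vS, unchart xe (y t)))) k =
      entry (unchart xe (y t)) 10 * entry (y t *m A) k
      + entry (unchart xe (y t)) k / entry (unchart xe (y t)) 10
      * entry (rhs p vS (unchart xe (y t)) (law (vS, unchart xe (y t)))) 10 ->
    is_derive t (1 : R)
      (fun s => (entry (y s) 10 + entry xe 10)
        * (entry (y s) k + entry xe k / entry xe 10))
      (entry (rhs p vS (unchart xe (y t)) (law (vS, unchart xe (y t)))) k).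
  move=> k12 yk ->; rewrite yk.
  have dk := dy k k12; have d10 := lin 10%N isT.
  have dk' : is_derive t (1 : R) (fun s => entry (y s) k + entry xe k / entry xe 10)
      (entry (y t *m A) k + 0).
    exact: (is_deriveD dk (is_derive_cst (entry xe k / entry xe 10) t 1)).
  have := is_deriveM d10 dk'; set v := (X in is_derive _ _ _ X -> _).
  set v' := (X in _ -> is_derive _ _ _ X); suff -> : v = v' by [].
  by rewrite /v /v' addr0 /GRing.scale/= [entry (unchart _ _) 10]entry_vec.
apply/is_derive_entryP.
apply: (@forall_1_to_12 (fun k => is_derive t (1 : R)
    (fun s => entry (unchart xe (y s)) k)
    (entry (rhs p vS (unchart xe (y t)) (law (vS, unchart xe (y t)))) k)));
  rewrite {1}/unchart;
  under [X in is_derive _ _ X _]eq_fun do rewrite entry_vec//=.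
all: try exact: lin.
- by apply: pro => //; rewrite /unchart !entry_vec//= mulrC mulKf.
- by apply: pro => //; rewrite /unchart !entry_vec//= mulrC mulKf.
Qed.

End Transfer.

(** * Asymptotic stability of the closed loop *)

Lemma lyapunov_decay (R : realType) (V : normedModType R) (F : V -> V)
    (q : V -> R) : lyapunov F q ->
  exists2 c, 0 < c & forall (t0 : R) (T : \bar R) (y : R -> V),
    {within [set t : R | t0 <= t /\ (t%:E < T)%E], continuous y} ->
    (forall t, t0 < t -> (t%:E < T)%E -> is_derive t (1 : R) y (F (y t))) ->
    forall t, t0 <= t -> (t%:E < T)%E ->
      q (y t) <= q (y t0) * expR (- c * (t - t0)).
Proof.
move=> [cq _ _ [c [dq [c0 fq dqle]]]]; exists c => // t0 T y cy dy.
apply: (@decay_le _ _ _ (q \o y) (dq \o y)).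
- move=> s; exact: (continuous_comp (cy s) (cq (y s))).
- by move=> t t0t tT; apply: fq; exact: dy.
- by move=> t t0t tT; exact: dqle.
Qed.

(** Once every coordinate is dominated, [q] is definite: with [M] above all the constants [K i],
    each squared coordinate is at most M q. *)
Lemma dominated_norm_lt (R : realType) (n : nat) (q : 'rV[R]_n -> R) :
  (forall i, dominated q (fun y : 'rV[R]_n => y ord0 i)) ->
  (forall y, 0 <= q y) ->
  forall e, 0 < e -> exists2 r, 0 < r & forall y, q y < r -> `|y| < e.
Proof.
move=> /choice[K qK] q0 e e0.
pose M := 1 + \sum_i `|K i|.
have M0 : 0 < M by rewrite ltr_pwDl// sumr_ge0.
exists (e ^+ 2 / M) => [|y qy]; first by rewrite divr_gt0// exprn_gt0.
apply: rV_norm_lt => // i.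
rewrite -(@ltr_pXn2r _ 2)// ?nnegrE ?ltW// real_normK ?num_real//.
apply: (le_lt_trans (qK i y)); apply: (@le_lt_trans _ _ (M * q y)).
  rewrite ler_wpM2r// (le_trans (ler_norm _))// /M (bigD1 i)//= addrCA lerDl.
  by rewrite addr_ge0// sumr_ge0.
by rewrite mulrC -ltr_pdivlMr.
Qed.

Section AsymptoticStability.
Variables (R : realType) (p : microgrid R) (xe : 'rV[R]_12) (u : 'rV[R]_5).
Variable gain : 'cV[R]_12.
Local Notation A :=
  (drift_mx p (1 - entry u 1) (1 - entry u 2) + gain *m unit_row R 8).
Local Notation law := (law p xe u gain).

Hypotheses (p_phys : physical p) (xe10 : entry xe 10 != 0).
Hypotheses (xe8 : entry xe 8 = 0) (xe79 : entry xe 7 = entry xe 9).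
Hypothesis xe_eq : rhs p 1 xe u = 0.
Variable q : 'rV[R]_12 -> R.
Hypothesis q_lyapunov : lyapunov (mulmx^~ A) q.
Hypothesis q_coord : forall i, dominated q (fun y : 'rV[R]_12 => y ord0 i).

(** No integral state: the controller state lives in the zero-dimensional space. *)
Definition static_feedback : feedback R 0 :=
  Feedback (fun w => law (w.1, w.2.1)) (fun=> 0).
Local Notation fb := static_feedback.
Local Notation ze := ((xe, 0) : 'rV[R]_12 * 'rV[R]_0).

Let dom (z : 'rV[R]_12 * 'rV[R]_0) : Prop := model_domain z.1.

Lemma law_cvg (T : Type) (F : set_system T) {FF : Filter F} (f : T -> R)
    (g : T -> 'rV[R]_12) v x :
  v != 0 -> entry x 10 != 0 -> f @ F --> v -> g @ F --> x ->
  law (f s, g s) @[s --> F] --> law (v, x).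
Proof.
move=> v0 x10 fv gx.
have gk k : entry (g s) k @[s --> F] --> entry x k.
  exact: (cvg_comp _ _ gx (@entry_continuous R 11 k x)).
have gV : (entry (g s) 10)^-1 @[s --> F] --> (entry x 10)^-1 by exact: cvgV.
have ck := cvg_cst.
have dc : dc_link_rate p (g s) @[s --> F] --> dc_link_rate p x.
  apply: cvgD.
    apply: cvgM; first by apply: cvgM; [exact: ck | apply: cvgM => //; exact: ck].
    by apply: cvgD; apply: cvgM => //; exact: ck.
  by apply: cvgM; [exact: ck | apply: cvgB].
have cr k : current_rate p xe k (g s) @[s --> F] --> current_rate p xe k x.
  apply: cvgB; first by apply: cvgM => //; apply: cvgM.
  apply: cvgM => //; apply: cvgB; last exact: ck.
  exact: cvgM.
have ch : chart xe (g s) @[s --> F] --> chart xe x by exact: chart_cvg.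
have cl : lform gain (chart xe (g s)) @[s --> F] --> lform gain (chart xe x).
  have cg := @lform_continuous R 12 gain (chart xe x).
  exact: (cvg_comp _ _ ch cg).
apply: cvg_entry; case=> [//|[|[|[|[|[|//]]]]]] _; rewrite /law entry_vec//=;
  under eq_fun do rewrite entry_vec//=.
- exact: ck.
- exact: ck.
- apply: cvgM; last exact: cvgV.
  by apply: cvgD; [exact: ck | apply: cvgM => //; exact: ck].
- apply: cvgM; first by apply: cvgM => //; exact: ck.
  apply: cvgD; last exact: ck.
  apply: cvgB; last by apply: cvgM => //; exact: ck.
  by apply: cvgD; apply: cvgM => //; exact: ck.
- apply: cvgM; first by apply: cvgM => //; exact: ck.
  apply: cvgD; last exact: ck.
  apply: cvgD; last by apply: cvgM => //; exact: ck.
  by apply: cvgD; apply: cvgM => //; exact: ck.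
Qed.

Lemma static_feedback_continuous : continuous_near fb ze.
Proof.
have : \forall z \near ze, entry z.1 10 != 0.
  have c10 : entry z.1 10 @[z --> ze] --> entry xe 10.
    have fst_ze : z.1 @[z --> ze] --> xe by exact: cvg_fst.
    exact: (cvg_comp _ _ fst_ze (@entry_continuous R 11 10 xe)).
  exact: cvgr_neq0 c10 xe10.
apply: filterS => z z10 vS vS0; split; last exact: cvg_cst.
apply: law_cvg => //; [by rewrite gt_eqF | exact: cvg_fst |].
have snd_z : w.2 @[w --> (vS, z)] --> z by exact: cvg_snd.
have fst_z : w.1 @[w --> z] --> z.1 by exact: cvg_fst.
exact: (cvg_comp _ _ snd_z fst_z).
Qed.

Let q_cont : continuous q. Proof. by case: q_lyapunov. Qed.
Let q_ge0 y : 0 <= q y. Proof. by case: q_lyapunov. Qed.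
Let q0 : q 0 = 0. Proof. by case: q_lyapunov. Qed.

Let norm_state (z : 'rV[R]_12 * 'rV[R]_0) : `|z - ze| = `|z.1 - xe|.
Proof.
rewrite prod_normE/= [z.2 - 0]thinmx0 normr0; apply/max_idPl; exact: normr_ge0.
Qed.

(** With [chart_near], compares balls around [xe] with sublevel sets of [q] in the chart, one lemma
    for each inclusion; stability is then decided on [q] alone. *)
Let unchart_near e : 0 < e ->
  exists2 r, 0 < r & forall y, q y < r -> `|unchart xe y - xe| < e.
Proof.
move=> e0.
have : unchart xe y @[y --> (0 : 'rV[R]_12)] --> xe.
  rewrite -[X in _ --> X](unchart0 xe10).
  by apply: (@unchart_cvg _ xe _ (nbhs (0 : 'rV[R]_12)) _ id); exact: cvg_id.
move=> /cvgrPdist_lt/(_ e e0)/nbhs_norm0P[/= h h0 hxe].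
have [r r0 rh] := dominated_norm_lt q_coord q_ge0 h0.
by exists r => // y /rh /hxe; rewrite distrC.
Qed.

Let chart_near r : 0 < r -> exists2 d, 0 < d &
  forall x, `|x - xe| < d -> entry x 10 != 0 /\ q (chart xe x) < r.
Proof.
move=> r0.
have cx : chart xe x @[x --> xe] --> (0 : 'rV[R]_12).
  rewrite -(chart_xe xe).
  by apply: (@chart_cvg _ xe _ (nbhs xe) _ id) => //; exact: cvg_id.
have cq : q (chart xe x) @[x --> xe] --> (0 : R).
  have q_cont0 : q y @[y --> (0 : 'rV[R]_12)] --> (0 : R).
    by rewrite -[X in _ --> X]q0; exact: q_cont.
  exact: (cvg_comp _ _ cx q_cont0).
have n10 : \forall x \near xe, entry x 10 != 0.
  exact: cvgr_neq0 (@entry_continuous R 11 10 xe) xe10.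
have nq : \forall x \near xe, q (chart xe x) < r.
  move/cvgrPdist_lt : cq => /(_ r r0); apply: filterS => x.
  by rewrite sub0r normrN; exact/le_lt_trans/ler_norm.
have : \forall x \near xe, entry x 10 != 0 /\ q (chart xe x) < r.
  by apply: filterS2 n10 nq => x; split.
move=> /nbhs_normP[/= d d0 dxe]; exists d => // x xd.
by apply: dxe; rewrite /= distrC.
Qed.

(** * The closed loop for a given supercapacitor voltage *)

Section SuperCapacitor.
Variable VS : R -> R.
Hypothesis VS_gt0 : forall t, 0 <= t -> 0 < VS t.
Local Notation CL := (closed_loop p fb VS).

Let VS_neq0 t0 t : 0 <= t0 -> t0 <= t -> VS t != 0.
Proof. by move=> t00 t0t; rewrite gt_eqF// VS_gt0// (le_trans t00). Qed.

(** Staying where x10 <> 0 is part of being a solution, so the whole trajectory can be read in the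
    chart, where the dynamics is linear and free of V_S. *)
Let solution_decay : exists2 c, 0 < c &
  forall t0 T z, 0 <= t0 -> is_solution CL dom t0 T z ->
  forall t, t0 <= t -> (t%:E < T)%E ->
    q (chart xe (z t).1) <= q (chart xe (z t0).1) * expR (- c * (t - t0)).
Proof.
have [c c0 cP] := lyapunov_decay q_lyapunov; exists c => // t0 T z t00 [cz dz zP].
apply: (cP t0 T (fun t => chart xe (z t).1)).
- apply/subspace_continuousP => s [t0s sT].
  apply: chart_cvg; first exact: dz.
  have zs := (subspace_continuousP _ _).1 cz s (conj t0s sT).
  exact: (cvg_comp _ _ zs (@cvg_fst _ _ _ _ _)).
- move=> t t0t tT; have /is_derive_pairP[zt _] := zP t t0t tT.
  apply: (is_derive_chart p_phys xe10 xe8 xe79 xe_eq (vS := VS t)) => //.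
  + exact: VS_neq0 t00 (ltW t0t).
  + exact: dz t (ltW t0t) tT.
Qed.

Let equilibrium : is_equilibrium CL dom ze.
Proof.
split=> // t t0; have VSt := VS_neq0 (lexx 0) t0.
have [X X10 X11 X12] := rhs_law gain p_phys xe10 xe8 xe79 xe_eq VSt xe10.
move: X X11 X12; rewrite chart_xe mul0mx => X X11 X12.
congr (_, _); apply: entryP => k k12 /=; rewrite entry0.
have [k10|] := leqP k 10; first by rewrite X ?entry0//; case/andP: k12 => ->.
have e10 := X 10%N isT; rewrite entry0 in e10.
rewrite leq_eqVlt => /predU1P[<-|k11].
  by rewrite X11 e10 entry0 !mulr0 addr0.
have -> : k = 12%N by apply/eqP; rewrite eqn_leq k11 andbT; case/andP: k12.
by rewrite X12 e10 entry0 !mulr0 addr0.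
Qed.

Let stable : lyapunov_stable CL dom ze.
Proof.
move=> t0 t00 e e0; have [c c0 decay] := solution_decay.
have [r r0 re] := unchart_near e0; have [d d0 dr] := chart_near r0.
exists d => // T z zP; rewrite norm_state => /dr[_ qr] t t0t tT.
rewrite norm_state; have [_ dz _] := zP.
rewrite -(chartK xe (dz t t0t tT)); apply: re.
apply: le_lt_trans qr; apply: le_trans (decay _ _ _ t00 zP t t0t tT) _.
rewrite ler_piMr ?q_ge0// -[leRHS]expR0 ler_expR mulNr oppr_le0.
by apply: mulr_ge0; rewrite ?subr_ge0// ltW.
Qed.

(** The linear system has a solution for all times. The decay of [q] keeps it in a sublevel set on
    which x10 cannot vanish, so it maps back to a solution of the model. *)
Let global_solution t0 : 0 <= t0 -> exists2 d, 0 < d &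
  forall z0, `|z0 - ze| < d ->
    exists2 z : R -> _, is_solution CL dom t0 +oo%E z & z t0 = z0.
Proof.
move=> t00; have [c c0 decay] := lyapunov_decay q_lyapunov.
(* A state with x10 = 0 lies at distance at least this number from [xe]. *)
have e0 : 0 < `|entry xe 10| by rewrite normr_gt0.
have [r r0 re] := unchart_near e0; have [d d0 dr] := chart_near r0.
exists d => // -[x0 a0]; rewrite norm_state/= => /dr[x010 qr].
have [y yt0 dy] := linear_ode_solution A t0 (chart xe x0).
have cy : continuous y.
  move=> t; apply: differentiable_continuous; apply/derivable1_diffP.
  by have [] := dy t.
have y10 t : t0 <= t -> entry (unchart xe (y t)) 10 != 0.
  move=> t0t; apply/eqP => x10.
  have : `|unchart xe (y t) - xe| < `|entry xe 10|.
    apply: re; apply: le_lt_trans qr; rewrite -yt0.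
    apply: le_trans (decay t0 +oo%E y _ _ t t0t (ltry _)) _ => //.
      exact: continuous_subspaceT.
    rewrite ler_piMr ?q_ge0// -[leRHS]expR0 ler_expR mulNr oppr_le0.
    by apply: mulr_ge0; rewrite ?subr_ge0// ltW.
  apply/negP; rewrite -leNgt (le_trans _ (entry_norm_le _ 10))//.
  by rewrite entryD entryN x10 sub0r normrN.
exists (fun t => (unchart xe (y t), 0)); last first.
  by rewrite yt0 chartK// [a0]thinmx0.
split=> [|t t0t _|t t0t _].
- apply: continuous_subspaceT => t.
  have xt : unchart xe (y s) @[s --> t] --> unchart xe (y t).
    by apply: (@unchart_cvg _ xe _ (nbhs t) _ y); exact: cy.
  have a0t : (0 : 'rV[R]_0) @[_ --> t] --> (0 : 'rV[R]_0) by exact: cvg_cst.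
  exact: (cvg_pair xt a0t).
- exact: y10.
- apply/is_derive_pairP; split; last exact: (is_derive_cst 0).
  apply: (is_derive_unchart p_phys xe10 xe8 xe79 xe_eq (vS := VS t)) => //.
  + exact: VS_neq0 t00 (ltW t0t).
  + by have := y10 t (ltW t0t); rewrite /unchart entry_vec.
Qed.

Let attractive : locally_attractive CL dom ze.
Proof.
move=> t0 t00; have [c c0 decay] := solution_decay.
have [d d0 exz] := global_solution t00; exists d => //; split=> // z zP _.
apply/cvgrPdist_lt => e e0; have [r r0 re] := unchart_near e0.
pose q1 := q (chart xe (z t0).1).
near=> t.
have t0t : t0 <= t by near: t; apply: nbhs_pinfty_ge; rewrite num_real.
(* By exp(s) >= 1 + s, this already gives q1 < r exp(c (t - t0)), without a logarithm. *)
have qt : q1 / (r * c) < t - t0.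
  rewrite ltrBrDr; near: t; apply: nbhs_pinfty_gt; rewrite num_real//.
have [_ dz _] := zP.
rewrite distrC norm_state -(chartK xe (dz t t0t (ltry _))); apply: re.
apply: le_lt_trans (decay _ _ _ t00 zP t t0t (ltry _)) _.
rewrite -/q1 mulNr expRN ltr_pdivrMr ?expR_gt0//.
move: qt; rewrite invfM mulrA ltr_pdivrMr// ltr_pdivrMr// => qt.
apply: (lt_le_trans qt); rewrite mulrC ler_pM2l// [(t - t0) * c]mulrC.
by apply: le_trans (expR_ge1Dx _); rewrite lerDr.
Unshelve. all: by end_near. Qed.

Lemma static_feedback_stable : asymptotically_stable CL dom ze.
Proof. by split. Qed.

End SuperCapacitor.

End AsymptoticStability.

Unset Implicit Arguments.

Theorem theorem1 (R : realType) (p : microgrid R)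
    (x1s x4s x9s x11s x12s : R) (x2s x5s x10s : R) :
  physical p ->
  power_balance p x1s x2s x4s x5s x9s x10s x11s x12s ->
  exists (n : nat) (fb : feedback R n) (alphae : 'rV[R]_n),
    let ze := (xeq p x1s x2s x4s x5s x9s x10s x11s x12s, alphae) in
    continuous_near fb ze /\
    forall VS : R -> R,
      (forall t : R, 0 <= t -> 0 < VS t) ->
      {within [set t : R | 0 <= t], continuous VS} ->
      asymptotically_stable (closed_loop p fb VS)
        (fun z : 'rV[R]_12 * 'rV[R]_n => model_domain z.1) ze.
Proof.
move=> p_phys [x10s0 [u1 [u2 [u3 [u4 [u5 eq0]]]]]].
set xe := xeq p x1s x2s x4s x5s x9s x10s x11s x12s.
(* The equilibrium equations are taken at V_S = 1; the constants [u1] and [u2] that [law] reads from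
   [u] do not depend on V_S. *)
pose u := vec 5 [:: u1; u2; u3 1; u4; u5].
have xe_eq : rhs p 1 xe u = 0 by exact: eq0.
have xe10 : entry xe 10 != 0 by rewrite entry_vec.
have xe8 : entry xe 8 = 0 by rewrite entry_vec.
have xe79 : entry xe 7 = entry xe 9 by rewrite !entry_vec.
(* The alternative always holds: for d = 0 the effective resistance is [R02 p], which is
   positive. *)
have d0r : 1 - entry u 1 != 0 \/ 0 < boost_resistance p (1 - entry u 1).
  have [->|] := eqVneq (1 - entry u 1) 0; last by left.
  right; rewrite /boost_resistance mulr0 add0r subr0 mulr1.
  by case: p_phys => _ _ [[]].
have [k [q [lq q_coord]]] := drift_stabilization (1 - entry u 2) p_phys d0r.
exists 0%N, (static_feedback p xe u k), 0; split.
  exact: static_feedback_continuous.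
move=> VS VS_gt0 _.
exact: (static_feedback_stable p_phys xe10 xe8 xe79 xe_eq lq q_coord VS_gt0).
Qed.
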